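(* Let $(\Sigma,\mathcal{B},\mu)$ be a $\sigma$-finite measure space, let $\mathcal{E}: L^2(\Sigma,\mu)\to(-\infty,\infty]$ be a proper, lower semicontinuous, convex functional, and let $\phi:\mathbb{R}\to\mathbb{R}$ be a continuous, strictly increasing and surjective function with $\phi(0)=0$. Let $A=\partial\mathcal{E}\cap\big(L^{1\cap\infty}\times L^{1\cap\infty}\big)$ be the part in $L^{1\cap\infty}:=L^1(\Sigma,\mu)\cap L^\infty(\Sigma,\mu)$ of the subgradient $\partial\mathcal{E}$ of $\mathcal{E}$ in $L^2$. Suppose that: (i) $(0,0)\in A$ (equivalently, $\mathcal{E}(0)=\min_{L^2}\mathcal{E}$); (ii) for every $u,\hat u\in L^2$ and every $T\in\mathcal{P}_0$, $$\mathcal{E}\big(u+T(\hat u-u)\big)+\mathcal{E}\big(\hat u-T(\hat u-u)\big)\le\mathcal{E}(u)+\mathcal{E}(\hat u);$$ (iii) for every $\lambda>0$, the Yosida operator $[\phi^{-1}]_\lambda$ of $\phi^{-1}$ satisfies $$\int_\Sigma v\,[\phi^{-1}]_\lambda u\,d\mu\ge0\quad\text{and}\quad\int_\Sigma v\,\operatorname{sign}_0\big([\phi^{-1}]_\lambda u\big)\,d\mu\ge0\qquad\text{for every }(u,v)\in A;$$ (iv) for every $u\in D(\mathcal{E}\phi)$, one has $u^+\in D(\mathcal{E}\phi)$ and $u^-\in D(\mathcal{E}\phi)$. Then the domain $D(A\phi)$ is a dense subset of $D(\mathcal{E}\phi)$ in $L^1$; that is, $D(A\phi)\subseteq D(\mathcal{E}\phi)$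 and every $f\in D(\mathcal{E}\phi)$ is the limit in the $L^1(\Sigma,\mu)$-norm of a sequence of elements of $D(A\phi)$.
   Context: All functions are real-valued ($\mu$-a.e. equivalence classes), $L^q=L^q(\Sigma,\mu)$, and $\langle u,v\rangle_{L^2}=\int_\Sigma uv\,d\mu$. The effective domain of $\mathcal{E}$ is $D(\mathcal{E})=\{u\in L^2: \mathcal{E}(u)<\infty\}$. The subgradient of $\mathcal{E}$ in $L^2$ is the (possibly multivalued) operator, identified with its graph, $$\partial\mathcal{E}=\{(u,h)\in D(\mathcal{E})\times L^2:\ \langle h,v-u\rangle_{L^2}\le\mathcal{E}(v)-\mathcal{E}(u)\ \text{for all }v\in L^2\}.$$ For an operator $B$ given by its graph, $Bu=\{v:(u,v)\in B\}$ and $D(B)=\{u: Bu\ne\emptyset\}$. The composed operator $A\phi$ in $L^1$ is $$A\phi=\{(u,v)\in L^1\times L^1:\ \phi(u)\in D(A)\ \text{and}\ v\in A(\phi(u))\},$$ where $\phi(u)(x)=\phi(u(x))$ for $\mu$-a.e. $x\in\Sigma$ (and $\phi$, as an operator in $L^1$, is the graph of pairs $(u,h)\in L^1\times L^1$ with $h=\phi(u)$ $\mu$-a.e.). $D(\mathcal{E}\phi)=\{u\in L^{1\cap\infty}:\ \phi(u)\in D(\mathcal{E})\}$. $\mathcal{P}_0$ is the set of all differentiable functions $T\in C(\mathbb{R})$ satisfying $T(0)=0$, $0\le T'\le1$, and such that $T'$ has compact support; $T(w)$ for a function $w$ means pointwise composition. For $\lambda>0$, the Yosida operator of $\phi^{-1}$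 is $[\phi^{-1}]_\lambda=\lambda^{-1}\big(I-(I+\lambda\phi^{-1})^{-1}\big)$, acting on functions pointwise $\mu$-a.e. ($I$ is the identity). $\operatorname{sign}_0(s)=1$ if $s>0$, $0$ if $s=0$, $-1$ if $s<0$. $u^+=\max\{u,0\}$ and $u^-=\min\{u,0\}$ (so $u^-\le 0$). *)

(* Defs.v *)
From HB Require Import structures.
From mathcomp Require Import all_boot all_order all_algebra.
From mathcomp Require Import all_classical all_reals all_analysis.

Set Implicit Arguments.
Unset Strict Implicit.
Unset Printing Implicit Defensive.
Import Order.TTheory GRing.Theory Num.Theory.
Import numFieldNormedType.Exports.

Local Open Scope classical_set_scope.
Local Open Scope ring_scope.

(* An element of L^q(mu) is given by a measurable representative, that is, by a
   function in [Lfun mu q].  A functional on L^2(mu) is a map on functions,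
   looked at on [Lfun mu 2%:E] only, that does not separate functions that are
   equal mu-a.e. ([ae_invariant]); its values outside [Lfun mu 2%:E] are never
   used.  An operator is a set of pairs of representatives. *)

Section functionals.
Context d (X : measurableType d) (R : realType).
Variables (mu : {measure set X -> \bar R}) (E : (X -> R) -> \bar R).

Definition ae_invariant := forall u v : X -> R,
  u \in Lfun mu 2%:E -> v \in Lfun mu 2%:E -> u = v %[ae mu] -> E u = E v.

Definition proper_functional :=
  (forall u : X -> R, u \in Lfun mu 2%:E -> (-oo < E u)%E) /\
  (exists2 u : X -> R, u \in Lfun mu 2%:E & (E u < +oo)%E).

(* [lower_semicontinuous] of the library, written out for the L^2-seminorm since
   [Lfun mu 2%:E] carries no topology. *)
Definition lsc_functional := forall (u : X -> R) (a : R),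
  u \in Lfun mu 2%:E -> (a%:E < E u)%E ->
  exists2 e : R, 0 < e & forall v : X -> R, v \in Lfun mu 2%:E ->
    ('N[mu]_2%:E[EFin \o (v - u)%R] < e%:E)%E -> (a%:E < E v)%E.

(* At t = 0 and t = 1 the convention 0 * +oo = 0 makes the bound trivial. *)
Definition convex_functional := forall (u v : X -> R) (t : R),
  u \in Lfun mu 2%:E -> v \in Lfun mu 2%:E -> 0 <= t <= 1 ->
  (E (t *: u + (1 - t) *: v)%R <= t%:E * E u + (1 - t)%:E * E v)%E.

Definition effective_domain : set (X -> R) :=
  [set u | u \in Lfun mu 2%:E /\ (E u < +oo)%E].

Definition L2inner (u v : X -> R) : \bar R := (\int[mu]_x (u x * v x)%:E)%E.

Definition subgradient : set ((X -> R) * (X -> R)) :=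
  [set uh | [/\ effective_domain uh.1, uh.2 \in Lfun mu 2%:E &
    forall v : X -> R, v \in Lfun mu 2%:E ->
      (L2inner uh.2 (v - uh.1)%R <= E v - E uh.1)%E]].

Definition L1capLoo : set (X -> R) :=
  [set u | u \in Lfun mu 1%E /\ u \in Lfun mu +oo%E].

Definition subgradient_part : set ((X -> R) * (X -> R)) :=
  subgradient `&` (L1capLoo `*` L1capLoo).

Definition composed_domain (phi : R -> R) : set (X -> R) :=
  [set u | L1capLoo u /\ effective_domain (phi \o u)].

End functionals.

Definition composed_operator d (X : measurableType d) (R : realType)
    (mu : {measure set X -> \bar R}) (A : set ((X -> R) * (X -> R)))
    (phi : R -> R) : set ((X -> R) * (X -> R)) :=
  [set uv | [/\ uv.1 \in Lfun mu 1%E, uv.2 \in Lfun mu 1%E,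
    A.`1 (phi \o uv.1) & A (phi \o uv.1, uv.2)]].

(* [A] is dense in [D] for the L^1-norm. *)
Definition L1_dense_in d (X : measurableType d) (R : realType)
    (mu : {measure set X -> \bar R}) (A D : set (X -> R)) :=
  A `<=` D /\
  forall f : X -> R, D f -> exists2 g : nat -> X -> R,
    (forall n, A (g n)) &
    'N[mu]_1%:E[EFin \o (g n - f)%R]%E @[n --> \oo] --> 0%E.

Section scalar_functions.
Context (R : realType).

Definition P0 : set (R -> R) :=
  [set T : R -> R | [/\ continuous T, forall s : R, derivable T s 1, T 0 = 0,
    forall s : R, 0 <= derive1 T s <= 1 &
    compact (closure [set s : R | derive1 T s != 0])]].

(* ['pinv_(fun=> 0) setT f] is the inverse of f when f is a bijection. *)
Definition resolvent (b : R -> R) (lambda : R) : R -> R :=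
  'pinv_(fun=> 0) setT (fun s => s + lambda * b s).

Definition yosida (b : R -> R) (lambda : R) (s : R) : R :=
  lambda^-1 * (s - resolvent b lambda s).

Definition inverse_fun (phi : R -> R) : R -> R := 'pinv_(fun=> 0) setT phi.

End scalar_functions.

(* Main.v *)
Require Import Defs.
From mathcomp Require Import all_boot all_order all_algebra.
From mathcomp Require Import all_classical all_reals all_analysis.
From mathcomp Require Import measurable_realfun ess_sup_inf ring lra.
Import Order.TTheory GRing.Theory Num.Theory.
Import numFieldNormedType.Exports.

Local Open Scope classical_set_scope.
Local Open Scope ring_scope.

Set Implicit Arguments.
Unset Strict Implicit.

(* Put psi = phi^-1 and let b be psi truncated outside a large interval.  For f in
   D(E phi) and delta > 0 the strongly convex lower semicontinuous functional
     w |-> delta E(w) + \int (delta w - f)^2 / (2 delta) + j(w),   j' = b,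
   has a minimizer w in L^2.  Since E(w - T(w)) <= E(w) for T in P_0 (take u = 0
   in (ii) and use that 0 minimizes E), comparing w with w - T(w) for suitable T
   gives a uniform bound on w and ||delta w + b(w)||_1 <= ||f||_1, hence w and b(w)
   lie in L^1 and L^oo.  The Euler-Lagrange equation then holds,
     delta (w + v) + b(w) = f  with (w, v) in A,
   so that g := psi(w) = b(w) is in D(A phi).  Testing it with phi(f) shows that
     \int (f - g) (phi(f) - w) <= delta C.
   Along delta = 2^-n the integrands are summable a.e., so g_n -> f a.e., and with
   ||g_n||_1 <= ||f||_1 the convergence holds in L^1. *)

(** * Convex primitives and contractions *)

(** The measure may be infinite, so a bounded function times an L^2 function need not be integrable;
    this shapes most of the proof. Completing the square makes the integral part of the functional
    an integral of nonnegative functions, meaningful on all of L^2 and suited to Fatou. The term b(w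
    - T(w)) T(w) is integrable because it lies between 0 and j(w). The Euler-Lagrange inequality is
    first proved against test functions in L^1.

    The functional E is abstract and is controlled from above only at a few competitors: w - T(w),
    by the contraction hypothesis, and points of a segment ending at w, by convexity. The first kind
    gives the a priori bounds (T growing only beyond M, or T an approximate sign), the second gives
    the equation.

    Truncation makes b bounded, hence j Lipschitz. Since |w| <= M almost everywhere, the truncated b
    agrees with psi on the values of w, and the approximate equation is solved for phi itself. *)

Section primitive.
Context (R : realType) (b : R -> R).
Hypothesis b_cont : continuous b.
Hypothesis b_nd : {homo b : x y / x <= y}.

Let I (x y : R) : R := (\int[lebesgue_measure]_(t in `[x, y]) b t)%R.

Let b_int (x y : R) : lebesgue_measure.-integrable `[x, y] (EFin \o b).
Proof.
apply: continuous_compact_integrable; first exact: segment_compact.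
exact: continuous_subspaceT.
Qed.

Let I_bounds (x y : R) : x <= y -> b x * (y - x) <= I x y <= b y * (y - x).
Proof.
move=> xy; have c k : \int[lebesgue_measure]_(t in `[x, y]) (fun=> k) t = k * (y - x) :> R.
  rewrite Rintegral_cst//= lebesgue_measure_itv/= lte_fin.
  by case: ltgtP xy => [_|//|->] _ /=; rewrite ?subrr.
have ci k : lebesgue_measure.-integrable `[x, y] (EFin \o (fun=> k : R)).
  apply: continuous_compact_integrable; first exact: segment_compact.
  by apply: continuous_subspaceT => ?; exact: cvg_cst.
rewrite -!c; apply/andP; split; apply: le_Rintegral => //= t;
  by rewrite in_itv/= => /andP[? ?]; exact: b_nd.
Qed.

Let I_chasles (a x y : R) : a <= x -> x <= y -> I a y - I a x = I x y.
Proof.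
move=> ax xy; rewrite /I Rintegral_itvB ?bnd_simp//.
rewrite Rintegral_itv_obnd_cbnd//; apply: integrableS (b_int x y) => //.
by apply: subset_itvr; rewrite bnd_simp.
Qed.

(** The integral of [b] over an interval lies between its length times the end values of [b]. The
    resulting subgradient inequality is the form in which later steps use [j]: it encodes convexity
    and, for bounded [b], the Lipschitz bound. *)
Lemma nondecreasing_primitive :
  exists2 j : R -> R, j 0 = 0 & forall r s, b r * (s - r) <= j s - j r.
Proof.
(* Starting both integrals to the left of [0] and of [s] gives the oriented integral from [0] to [s]
   for either sign of [s]; by additivity any base point further left gives the same value. *)
pose j s := I (Num.min s 0) s - I (Num.min s 0) 0.
have jE a s : a <= s -> a <= 0 -> j s = I a s - I a 0.
  move=> as_ a0; have am : a <= Num.min s 0 by rewrite le_min as_.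
  rewrite /j -(@I_chasles a _ s)// ?ge_min ?lexx// -(@I_chasles a _ 0)//;
    last by rewrite ge_min lexx orbT.
  by lra.
exists j; first by rewrite /j subrr.
move=> r s; pose a := Num.min (Num.min r s) 0.
rewrite (jE a s) ?(jE a r) ?ge_min ?lexx ?orbT//.
have [rs|/ltW sr] := leP r s.
  have := I_bounds rs; rewrite -(I_chasles _ rs (a := a)) ?ge_min ?lexx ?orbT//.
  by lra.
have := I_bounds sr; rewrite -(I_chasles _ sr (a := a)) ?ge_min ?lexx ?orbT//.
by lra.
Qed.
End primitive.

(** * Elements of P0 that approximate sign, threshold and cut-off functions *)

Section contractions.
Context (R : realType).
Implicit Types (a e s x y : R) (T : R -> R).

Lemma P0_nondecreasing T x y : P0 T -> x <= y -> 0 <= T y - T x <= y - x.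
Proof.
move=> [Tc dT _ bT _]; rewrite le_eqVlt => /predU1P[->|xy].
  by rewrite !subrr lexx.
have [||c _ ->] := @MVT R T (derive1 T) x y xy.
- by move=> z _; split; [exact: dT|rewrite derive1E].
- exact: continuous_subspaceT.
by have := bT c; nra.
Qed.

(** Meant for piecewise quadratic C^1 functions: a uniform quadratic remainder spares any case split
    at the breakpoints. *)
Lemma is_derive_quadratic (f : R -> R) (x l C : R) :
  (forall h, `|f (x + h) - f x - l * h| <= C * h ^+ 2) -> is_derive x 1 f l.
Proof.
move=> fl; have cv : (h^-1 *: ((f \o shift x) (h *: 1) - f x)) @[h --> 0^'] --> l.
  apply/cvgrPdist_le => /= e e0; near=> h.
  have h0 : h != 0 by near: h; exact: nbhs_dnbhs_neq.
  have := fl h; rewrite /= /GRing.scale/= mulr1 (addrC h).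
  set k := f (x + h) - f x => klh.
  have -> : l - h^-1 * k = - h^-1 * (k - l * h) by field.
  rewrite normrM normrN normfV ler_pdivrMl ?normr_gt0//.
  rewrite (le_trans klh)// -real_normK ?num_real// expr2 mulrCA ler_wpM2l//.
  have C1 : C <= `|C| + 1 by rewrite (le_trans (ler_norm _))// lerDl.
  rewrite (le_trans (ler_wpM2r _ C1))// -ler_pdivlMl ?ltr_wpDl//.
  near: h; apply: dnbhs0_le; rewrite mulr_gt0// invr_gt0 ltr_wpDl//.
apply: DeriveDef; first by apply/cvg_ex; exists l.
exact/cvg_lim.
Unshelve. all: by end_near. Qed.

Let pos2 x := Num.max x 0 ^+ 2.

Let pos2_quadratic x h :
  `|pos2 (x + h) - pos2 x - 2 * Num.max x 0 * h| <= h ^+ 2.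
Proof.
rewrite /pos2 ler_norml.
by have [|] := leP x 0; have [|] := leP (x + h) 0 => *; apply/andP; split; nra.
Qed.

(** A second difference with step [e] of the function max(s - a, 0)^2, divided by 2 e. It is C^1 and
    rises from 0 to [e] across [a - e, a + e]. *)
Let ramp a e s : R :=
  (Num.max (s - a + e) 0 ^+ 2 - 2 * Num.max (s - a) 0 ^+ 2
   + Num.max (s - a - e) 0 ^+ 2) / (2 * e).

Let tent a e s : R :=
  (Num.max (s - a + e) 0 - 2 * Num.max (s - a) 0 + Num.max (s - a - e) 0) / e.

Let is_derive_ramp a e s c : 0 < e ->
  is_derive s 1 (fun s => ramp a e s - c) (tent a e s).
Proof.
move=> e0; apply: (@is_derive_quadratic _ _ _ (2 / e)) => h.
have h1 := pos2_quadratic (s - a + e) h; have h2 := pos2_quadratic (s - a) h.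
have h3 := pos2_quadratic (s - a - e) h.
set D := (X in `|X|).
pose Q x := pos2 (x + h) - pos2 x - 2 * Num.max x 0 * h.
have -> : D = (Q (s - a + e) - 2 * Q (s - a) + Q (s - a - e)) / (2 * e).
  have e1 : s + h - a + e = s - a + e + h by lra.
  have e2 : s + h - a = s - a + h by lra.
  have e3 : s - a + h - e = s - a - e + h by lra.
  by rewrite /D /Q /ramp /tent /pos2 e1 e2 e3; field; lra.
rewrite normrM normfV (gtr0_norm (mulr_gt0 _ e0))// ler_pdivrMr ?mulr_gt0//.
have -> : 2 / e * h ^+ 2 * (2 * e) = 4 * h ^+ 2 by field; lra.
by move: h1 h2 h3; rewrite -!/(Q _) !ler_norml => /andP[? ?] /andP[? ?] /andP[? ?]; lra.
Qed.

(* The primitive vanishing at 0 of the tent function of height 1 supported on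
   [a - e, a + e]. *)
Definition soft_step a e s : R := ramp a e s - ramp a e 0.

Lemma soft_step_P0 a e : 0 < e -> P0 (soft_step a e).
Proof.
rewrite /soft_step.
move=> e0; have D s := is_derive_ramp a s (ramp a e 0) e0.
have dE : derive1 (fun s => ramp a e s - ramp a e 0) = tent a e.
  by apply/funext => s; rewrite derive1E derive_val.
split.
- move=> s; apply: differentiable_continuous; apply/derivable1_diffP.
  exact: (@ex_derive _ _ _ _ _ _ _ (D s)).
- by move=> s; exact: (@ex_derive _ _ _ _ _ _ _ (D s)).
- by rewrite subrr.
- move=> s; rewrite dE /tent ler_pdivrMr// ler_pdivlMr// mul0r mul1r.
  by have [] := leP (s - a + e) 0; have [] := leP (s - a) 0; have [] := leP (s - a - e) 0; lra.
- rewrite dE; apply: (@subclosed_compact _ _ `[a - e, a + e]).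
  + exact: closed_closure.
  + exact: segment_compact.
  rewrite closureE => s; apply; split; first exact: interval_closed.
  move=> t /=; apply: contra_neqT; rewrite in_itv/= negb_and -!ltNge => h.
  rewrite /tent; suff -> : Num.max (t - a + e) 0 - 2 * Num.max (t - a) 0 + Num.max (t - a - e) 0 = 0
    by rewrite mul0r.
  by move: h; have [] := leP (t - a + e) 0; have [] := leP (t - a) 0;
    have [] := leP (t - a - e) 0 => ? ? ? /orP[]; lra.
Qed.

Let ramp_center e : 0 < e -> ramp 0 e 0 = e / 2.
Proof.
move=> e0.
by rewrite /ramp !subr0 add0r sub0r maxxx (max_idPl _) ?(max_idPr _); [field| |]; lra.
Qed.

(** The tent has area [e], half of it on each side of its centre 0. For the same reason the bound is
    attained, with the sign of [s], as soon as [s] is outside (-e, e). *)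
Lemma soft_step_bound e s : 0 < e -> `|soft_step 0 e s| <= e / 2.
Proof.
move=> e0; have e20 : 0 < 2 * e by lra.
have r0 := ramp_center e0.
rewrite /soft_step r0 /ramp !subr0 ler_norml lerBrDr lerBlDr.
rewrite ler_pdivlMr// ler_pdivrMr//.
have -> : (- (e / 2) + e / 2) * (2 * e) = 0 by ring.
have -> : (e / 2 + e / 2) * (2 * e) = 2 * e ^+ 2 by field.
by have [?|?] := leP (s + e) 0; have [?|?] := leP s 0; have [?|?] := leP (s - e) 0;
  apply/andP; split; nra.
Qed.

(** The slope of the soft step at 0 is 1, so the difference is of second order there. It serves to
    put u - T(u) in L^1 when u is only in L^2. *)
Lemma soft_step_quadratic e s : 0 < e ->
  `|s - soft_step 0 e s| <= s ^+ 2 / (2 * e).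
Proof.
move=> e0; have e20 : 0 < 2 * e by lra.
have r0 := ramp_center e0.
rewrite /soft_step r0 ler_pdivlMr// -[X in _ * X]gtr0_norm// -normrM /ramp !subr0.
rewrite mulrBl mulrBl divfK ?gt_eqF//.
have -> : e / 2 * (2 * e) = e ^+ 2 by field.
rewrite ler_norml.
by have [?|?] := leP (s + e) 0; have [?|?] := leP s 0; have [?|?] := leP (s - e) 0;
  apply/andP; split; nra.
Qed.

Lemma soft_step_sign e s : 0 < e -> e <= `|s| ->
  soft_step 0 e s = e / 2 * Num.sg s.
Proof.
move=> e0; have e20 : 0 < 2 * e by lra.
have r0 := ramp_center e0.
rewrite /soft_step r0 /ramp !subr0.
case: (sgrP s) => [->|s0|s0].
- by rewrite leNgt e0.
- move=> es; by rewrite !(max_idPl _); [field; lra|lra|lra|lra].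
- move=> es; by rewrite !(max_idPr _); [field; lra|lra|lra|lra].
Qed.

(** The tent is placed on [M, M + 2], so that its primitive is nonzero exactly on the values
    exceeding [M]. The next lemma is the mirror image for values below [- M]. *)
Lemma soft_step_right M s : 0 <= M ->
  (s <= M -> soft_step (M + 1) 1 s = 0) /\ (M < s -> 0 < soft_step (M + 1) 1 s).
Proof.
move=> M0; rewrite /soft_step.
have -> : ramp (M + 1) 1 0 = 0.
  by rewrite /ramp !(max_idPr _); [field|lra|lra|lra].
rewrite subr0 /ramp; split => h.
  by rewrite !(max_idPr _); [field|lra|lra|lra].
rewrite divr_gt0 ?mulr_gt0//.
have [?|?] := leP (s - (M + 1) + 1) 0; have [?|?] := leP (s - (M + 1)) 0;
  have [?|?] := leP (s - (M + 1) - 1) 0; nra.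
Qed.

Lemma soft_step_left M s : 0 <= M ->
  (- M <= s -> soft_step (- (M + 1)) 1 s = 0) /\
  (s < - M -> soft_step (- (M + 1)) 1 s < 0).
Proof.
move=> M0; rewrite /soft_step.
have -> : ramp (- (M + 1)) 1 0 = 1.
  by rewrite /ramp !(max_idPl _) ; [field| | |]; lra.
rewrite /ramp; split => h.
  by rewrite !(max_idPl _); [field| | |]; lra.
rewrite subr_lt0 ltr_pdivrMr ?mul1r//.
have [?|?] := leP (s - - (M + 1) + 1) 0; have [?|?] := leP (s - - (M + 1)) 0;
  have [?|?] := leP (s - - (M + 1) - 1) 0; nra.
Qed.

End contractions.

(** * Integration and completeness of L^2 *)

Section Lfun_facts.
Context d (X : measurableType d) (R : realType).
Variable mu : {measure set X -> \bar R}.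
Implicit Types u v f g : X -> R.

Lemma Lfun_measurable (p : \bar R) u : u \in Lfun mu p -> measurable_fun setT u.
Proof. by rewrite inE => /andP[/[!inE]]. Qed.

Lemma Lfun_lin (p : \bar R) u v (a : R) : (1 <= p)%E ->
  u \in Lfun mu p -> v \in Lfun mu p -> (fun x => a * u x + v x) \in Lfun mu p.
Proof. by move=> p1; exact: (Lfun_submod_closed mu p1).2. Qed.

Lemma Lfun2P u : u \in Lfun mu 2%:E <->
  measurable_fun setT u /\ mu.-integrable setT (EFin \o (fun x => u x ^+ 2)).
Proof.
split=> [uL|[mu_ /integrableP[_ ui]]].
  by split; [exact: Lfun_measurable uL|exact: Lfun2_integrable_sqr].
rewrite inE; apply/andP; split; rewrite inE//=.
rewrite /finite_norm unlock poweR_lty//; apply: le_lt_trans ui.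
rewrite le_eqVlt; apply/orP; left; apply/eqP; apply: eq_integral => x _.
by rewrite /= powR_mulrn// normrX real_normK ?num_real.
Qed.

Lemma Lnorm2_lt u (e : R) : 0 < e ->
  (\int[mu]_x (u x ^+ 2)%:E < (e ^+ 2)%:E)%E -> ('N[mu]_2%:E[EFin \o u] < e%:E)%E.
Proof.
move=> e0 ue.
rewrite ltNge; apply/negP => eN.
have : ((e ^+ 2)%:E <= 'N[mu]_2%:E[EFin \o u] `^ 2)%E.
  rewrite -powR_mulrn ?(ltW e0)// -poweR_EFin gt0_ler_poweR //.
  - by rewrite in_itv/= leey lee_fin ltW.
  - by rewrite in_itv/= leey Lnorm_ge0.
rewrite poweR_Lnorm// leNgt => /negP; apply.
under eq_integral => x _ do rewrite /= powR_mulrn// real_normK ?num_real//.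
exact: ue.
Qed.

Lemma LfunooP u : u \in Lfun mu +oo%E <->
  measurable_fun setT u /\ exists M : R, {ae mu, forall x, `|u x| <= M}.
Proof.
split=> [uL|[mu_ [M uM]]].
  split; first exact: Lfun_measurable uL.
  move: uL; rewrite inE => /andP[_]; rewrite inE/= /finite_norm unlock.
  case: ifPn => [_ ?|]; first exact: (@ess_supr_bounded _ _ _ mu (Num.norm \o u)).
  rewrite -leNgt measure_le0 => /eqP mu0 _; exists 0.
  exists setT; split => //.
rewrite inE; apply/andP; split; rewrite inE//=.
rewrite /finite_norm unlock; case: ifPn => // _.
apply: (@le_lt_trans _ _ M%:E); last exact: ltry.
by apply/ess_supP; apply: filterS uM => x; rewrite /= lee_fin.
Qed.

Lemma L1capLoo_Lfun2 u : L1capLoo mu u -> u \in Lfun mu 2%:E.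
Proof.
move=> [/Lfun1_integrable u1 /LfunooP[mu_ [M uM]]].
apply/Lfun2P; split => //; apply/integrableP; split.
  by apply/measurable_EFinP; exact: measurable_funX.
apply: (@le_lt_trans _ _ (\int[mu]_x `|(M * u x)%:E|)%E).
  apply: ae_ge0_le_integral => //.
  - by apply: measurableT_comp => //; apply/measurable_EFinP; exact: measurable_funX.
  - by apply: measurableT_comp => //; apply/measurable_EFinP; exact: measurable_funM.
  apply: filterS uM => x uM _; rewrite lee_fin normrX normrM expr2.
  by rewrite ler_wpM2r// (le_trans uM)// ler_norm.
by have /integrableP[] := integrableZl measurableT M u1.
Qed.

Lemma Lfun2_integrableM u v : u \in Lfun mu 2%:E -> v \in Lfun mu 2%:E ->
  mu.-integrable setT (EFin \o (fun x => u x * v x)).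
Proof. by move=> uL vL; apply/Lfun1_integrable; exact: Lfun2_mul_Lfun1. Qed.

Lemma L1capLoo_lin u v (a : R) :
  L1capLoo mu u -> L1capLoo mu v -> L1capLoo mu (fun x => a * u x + v x).
Proof. by move=> [? ?] [? ?]; split; apply: Lfun_lin => //; exact: leey. Qed.

Lemma fatou_ae (g_ : nat -> X -> R) g (C : \bar R) :
  (forall n, measurable_fun setT (g_ n)) -> measurable_fun setT g ->
  (forall n x, 0 <= g_ n x) -> (forall x, 0 <= g x) ->
  {ae mu, forall x, g_ n x @[n --> \oo] --> g x} ->
  (\forall n \near \oo, (\int[mu]_x (g_ n x)%:E <= C)%E) ->
  (\int[mu]_x (g x)%:E <= C)%E.
Proof.
move=> mg_ mg g_0 g0 g_g [N _ NC].
pose G n x := (g_ n x)%:E.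
have mG n : measurable_fun setT (G n) by exact/measurable_EFinP.
have G0 n x : [set: X] x -> (0 <= G n x)%E by rewrite lee_fin.
have := fatou mu measurableT mG G0.
have -> : (\int[mu]_x limn_einf (G^~ x) = \int[mu]_x (g x)%:E)%E.
  apply: ae_eq_integral => //.
  - apply: (emeasurable_fun_cvg (fun n x => einfs (G ^~ x) n)).
      by move=> n; exact: measurable_fun_einfs.
    by move=> x _; rewrite limn_einf_lim; exact: is_cvg_einfs.
  - exact/measurable_EFinP.
  apply: filterS g_g => x gx _.
  rewrite (@cvg_limn_einf_sup _ (G^~ x) (g x)%:E)//.
  by apply: cvg_EFin => //; exact: nearW.
move/le_trans; apply.
rewrite limn_einf_lim; apply: lime_le.
  by apply/cvg_ex; eexists; apply: ereal_nondecreasing_cvgn; exact: nondecreasing_einfs.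
apply: nearW => k; apply: le_trans (NC (maxn N k) (leq_maxl _ _)).
by apply: ereal_inf_lbound; exists (maxn N k) => //=; exact: leq_maxr.
Qed.

End Lfun_facts.

(** * Almost everywhere limits of fast Cauchy sequences *)

Section L2_limits.
Context d (X : measurableType d) (R : realType).
Variable mu : {measure set X -> \bar R}.
Implicit Types u v f g : X -> R.

(** By monotone convergence the sum of the series has integral at most 2 C, hence is finite almost
    everywhere. *)
Lemma ae_cvg_series (a : nat -> X -> R) (C : R) :
  (forall n, measurable_fun setT (a n)) -> (forall n x, 0 <= a n x) ->
  (forall n, (\int[mu]_x (a n x)%:E <= (C * 2^-1 ^+ n)%:E)%E) ->
  {ae mu, forall x, cvgn (series (a ^~ x))}.
Proof.
move=> ma a0 aC.
have C0 : 0 <= C.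
  rewrite -lee_fin -(mulr1 C); apply: le_trans (aC 0%N).
  by apply: integral_ge0 => x _; rewrite lee_fin.
have A0 n x : [set: X] x -> (0 <= (a n x)%:E)%E by rewrite lee_fin.
have mA n : measurable_fun setT (fun x => (a n x)%:E) by exact/measurable_EFinP.
pose S x := (\sum_(n <oo) (a n x)%:E)%E.
have Sint : (\int[mu]_x S x <= (2 * C)%:E)%E.
  rewrite integral_nneseries//; apply: lime_le.
    by apply: is_cvg_nneseries => n _ _; apply: integral_ge0 => x; exact: A0.
  apply: nearW => n.
  apply: (@le_trans _ _ (\sum_(0 <= i < n) (C * 2^-1 ^+ i)%:E)%E).
    exact: lee_sum.
  rewrite sumEFin lee_fin -mulr_sumr mulrC ler_wpM2r//.
  suff -> : \sum_(0 <= i < n) 2^-1 ^+ i = 2 - 2 * 2^-1 ^+ n :> R.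
    by rewrite lerBlDr lerDl mulr_ge0// exprn_ge0.
  elim: n => [|n IH]; first by rewrite big_geq// expr0; ring.
  by rewrite big_nat_recr//= IH exprS; field.
have Si : mu.-integrable setT S.
  apply/integrableP; split.
    by apply: (ge0_emeasurable_sum (P := xpredT)) => *; [exact: A0|exact: mA].
  apply: le_lt_trans (ltry (2 * C)); apply: le_trans Sint.
  rewrite le_eqVlt; apply/orP; left; apply/eqP; apply: eq_integral => x _.
  by rewrite gee0_abs//; apply: nneseries_ge0 => *; exact: A0.
have := integrable_ae measurableT Si; apply: filterS => x /(_ I) Sx.
apply: nondecreasing_is_cvgn.
  by apply/nondecreasing_seqP => n; rewrite !seriesEnat/= big_nat_recr//= lerDl.
exists (fine (S x)) => _ [n _ <-].
rewrite -lee_fin fineK// seriesEnat/= -sumEFin; apply: nneseries_lim_ge => *; exact: A0.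
Qed.

Lemma ae_cvg0 (a : nat -> X -> R) (C : R) :
  (forall n, measurable_fun setT (a n)) -> (forall n x, 0 <= a n x) ->
  (forall n, (\int[mu]_x (a n x)%:E <= (C * 2^-1 ^+ n)%:E)%E) ->
  {ae mu, forall x, a n x @[n --> \oo] --> 0}.
Proof.
move=> ma a0 aC; have := ae_cvg_series ma a0 aC; apply: filterS => x.
exact: cvg_series_cvg_0.
Qed.

(** The Riesz-Fischer argument for a sequence that is already fast, so that the whole sequence
    converges almost everywhere. Fatou needs the pointwise limit; the lower semicontinuity of E
    needs the L^2 rate. *)
Lemma L2_complete (u_ : nat -> X -> R) (C : R) :
  (forall n, u_ n \in Lfun mu 2%:E) ->
  (forall n k, (n <= k)%N ->
    (\int[mu]_x ((u_ k x - u_ n x) ^+ 2)%:E <= (C * 8^-1 ^+ n)%:E)%E) ->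
  exists2 u, u \in Lfun mu 2%:E &
    {ae mu, forall x, u_ n x @[n --> \oo] --> u x} /\
    forall n, (\int[mu]_x ((u x - u_ n x) ^+ 2)%:E <= (C * 8^-1 ^+ n)%:E)%E.
Proof.
move=> uL uC; have mu_ n := Lfun_measurable (uL n).
have C0 : 0 <= C.
  rewrite -lee_fin -(mulr1 C); apply: le_trans (uC 0%N 0%N (leqnn _)).
  by apply: integral_ge0 => x _; rewrite lee_fin sqr_ge0.
(* The rate 8^-n leaves room for the weight 2^n: the integrals are still at most C 4^-n, while
   summability of the weighted squares implies that of the increments themselves. *)
pose a n x := 2 ^+ n * (u_ n.+1 x - u_ n x) ^+ 2.
have ma n : measurable_fun setT (a n).
  by apply: measurable_funM => //; apply: measurable_funX; exact: measurable_funB.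
have a0 n x : 0 <= a n x by apply: mulr_ge0; [exact: exprn_ge0|exact: sqr_ge0].
have aC n : (\int[mu]_x (a n x)%:E <= (C * 2^-1 ^+ n)%:E)%E.
  under eq_integral => x _ do rewrite /a EFinM.
  rewrite ge0_integralZl//; last 2 first.
  - by apply/measurable_EFinP; apply: measurable_funX; exact: measurable_funB.
  - by move=> x _; rewrite lee_fin sqr_ge0.
  apply: (@le_trans _ _ ((2 ^+ n)%:E * (C * 8^-1 ^+ n)%:E)%E).
    by rewrite lee_pmul2l// ?lte_fin ?exprn_gt0// uC.
  rewrite -EFinM lee_fin mulrCA ler_wpM2l// -exprMn lerXn2r ?nnegrE; lra.
(* An upper limit is measurable and defined everywhere; off the set of convergence its value is
   irrelevant. *)
pose u x := fine (limn_esup (fun n => (u_ n x)%:E)).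
have m_u : measurable_fun setT u.
  apply: measurableT_comp => //.
  by apply: measurable_fun_limn_esup => n; exact/measurable_EFinP.
have u_u : {ae mu, forall x, u_ n x @[n --> \oo] --> u x}.
  have := ae_cvg_series ma a0 aC; apply: filterS => x ax.
  suff /cvg_ex[l ul] : cvgn (u_ ^~ x).
    suff -> : u x = l by [].
    rewrite /u (@cvg_limn_einf_sup _ _ l%:E)//.
    by apply: cvg_EFin => //; exact: nearW.
  pose t := telescope (u_ ^~ x).
  have tc : cvgn (series t).
    apply: normed_cvg; rewrite /normed_series_of/=.
    apply: (@series_le_cvg _ _ (fun n => 2^-1 ^+ n + a n x)) => //.
    - by move=> n; rewrite addr_ge0// exprn_ge0.
    - (* |z| <= 2^-n + 2^n z^2 *)
      move=> n; rewrite /= /t /telescope /a; set z := (X in `|X|).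
      have p0 : 0 < 2 ^+ n :> R by rewrite exprn_gt0.
      have z0 := normr_ge0 z; rewrite -[z ^+ 2]real_normK ?num_real// exprVn.
      rewrite -[leRHS](@mulfK _ (2 ^+ n)) ?gt_eqF// ler_pdivlMr// mulrDl mulVf ?gt_eqF//.
      by nra.
    - rewrite seriesD; apply: is_cvgD => //.
      have -> : GRing.exp (2^-1 : R) = geometric 1 (2^-1 : R).
        by apply/funext => n; rewrite /geometric/= mul1r.
      by apply: is_cvg_geometric_series; rewrite ger0_norm; lra.
  have -> : u_ ^~ x = (fun n => series t n + u_ 0%N x).
    by apply/funext => n; rewrite (eq_sum_telescope (u_ ^~ x)) addrC.
  by apply: is_cvgD => //; exact: is_cvg_cst.
(* Fatou with [n] fixed and the other index tending to infinity. *)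
have bound n : (\int[mu]_x ((u x - u_ n x) ^+ 2)%:E <= (C * 8^-1 ^+ n)%:E)%E.
  apply: (@fatou_ae _ _ _ mu (fun k x => (u_ k x - u_ n x) ^+ 2)) => //.
  - by move=> k; apply: measurable_funX; exact: measurable_funB.
  - by apply: measurable_funX; exact: measurable_funB.
  - by move=> k x; exact: sqr_ge0.
  - by move=> x; exact: sqr_ge0.
  - apply: filterS u_u => x ux; rewrite expr2; under eq_fun do rewrite expr2.
    by apply: cvgM; apply: cvgB => //; exact: cvg_cst.
  - by exists n => // k /=; exact: uC.
exists u => //.
have -> : u = (fun x => 1 * (u x - u_ 0%N x) + u_ 0%N x).
  by apply/funext => x; rewrite mul1r subrK.
apply: (@Lfun_lin _ _ _ mu 2%:E (fun x => u x - u_ 0%N x)) => //.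
  exact: (lee1n 2).
apply/Lfun2P; split; first exact: measurable_funB.
apply/integrableP; split.
  by apply/measurable_EFinP; apply: measurable_funX; exact: measurable_funB.
apply: le_lt_trans (ltry (C * 8^-1 ^+ 0)); apply: le_trans (bound 0%N).
rewrite le_eqVlt; apply/orP; left; apply/eqP; apply: eq_integral => x _.
by rewrite gee0_abs// lee_fin sqr_ge0.
Qed.

End L2_limits.

(** * Scheffe's lemma and minimization of strongly convex functionals *)

Section L2_minimization.
Context d (X : measurableType d) (R : realType).
Variable mu : {measure set X -> \bar R}.
Implicit Types u v f g : X -> R.

Lemma scheffe (g_ : nat -> X -> R) f :
  (forall n, g_ n \in Lfun mu 1%E) -> f \in Lfun mu 1%E ->
  {ae mu, forall x, g_ n x @[n --> \oo] --> f x} ->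
  (forall n, (\int[mu]_x `|(g_ n x)%:E| <= \int[mu]_x `|(f x)%:E|)%E) ->
  (\int[mu]_x `|(g_ n x - f x)%:E|)%E @[n --> \oo] --> 0%E.
Proof.
move=> gL fL gf gfle.
have mf := Lfun_measurable fL; have mg n := Lfun_measurable (gL n).
(* |g - f| <= |g| - |f| + 2 min(|f|, |g - f|), and the minimum is dominated by |f|. *)
pose h n x := Num.min `|f x| `|g_ n x - f x|.
have mh n : measurable_fun setT (h n).
  by apply: measurable_minr; apply: measurableT_comp => //; exact: measurable_funB.
have h0 n x : 0 <= h n x by rewrite le_min !normr_ge0.
have [|||||_ _ hcv] := @dominated_convergence _ _ _ mu setT measurableT
  (fun n x => (h n x)%:E) (cst 0%E) (fun x => `|(f x)%:E|%E).
- by move=> n; exact/measurable_EFinP.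
- exact: measurable_cst.
- apply: filterS gf => x gf _; apply: cvg_EFin; first exact: nearW.
  apply: (@squeeze_cvgr _ _ _ _ (cst 0) (fun n => `|g_ n x - f x|)).
  + by apply: nearW => n; rewrite h0 /h ge_min lexx orbT.
  + exact: cvg_cst.
  + have /cvg_norm : g_ n x - f x @[n --> \oo] --> f x - f x.
      by apply: cvgB => //; exact: cvg_cst.
    by rewrite subrr normr0.
- by apply: integrable_abse; exact/Lfun1_integrable.
- by apply: nearW => x n _; rewrite gee0_abs lee_fin// /h ge_min lexx.
rewrite integral0 in hcv.
have mabs u : measurable_fun setT u -> measurable_fun setT (fun x => `|(u x)%:E|%E).
  by move=> ?; apply: measurableT_comp => //; exact/measurable_EFinP.
have fin_f : (\int[mu]_x `|(f x)%:E| \is a fin_num)%E.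
  by apply: integrable_fin_num => //; apply: integrable_abse; exact/Lfun1_integrable.
have hle n : (\int[mu]_x `|(g_ n x - f x)%:E| <= 2%:E * \int[mu]_x (h n x)%:E)%E.
  have mgf : measurable_fun setT (fun x => g_ n x - f x) by exact: measurable_funB.
  (* Adding the finite integral of |f| to both sides replaces a subtraction of extended integrals;
     the norm bound on [g_ n] then enters on the right. *)
  rewrite -(leeD2rE _ _ fin_f) -ge0_integralD//; try exact: mabs.
  apply: (@le_trans _ _ (2%:E * \int[mu]_x (h n x)%:E + \int[mu]_x `|(g_ n x)%:E|)%E);
    last exact: leeD2l.
  rewrite -ge0_integralZl_EFin//; last 2 first.
  - by move=> x _; rewrite lee_fin.
  - exact/measurable_EFinP.
  rewrite -ge0_integralD//; last 3 first.
  - by move=> x _; rewrite -EFinM lee_fin mulr_ge0.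
  - by apply/measurable_EFinP; exact: measurable_funM.
  - exact: mabs.
  apply: ge0_le_integral => //.
  - by move=> x _; rewrite adde_ge0.
  - by apply: emeasurable_funD; exact: mabs.
  - by apply: emeasurable_funD; [apply/measurable_EFinP; exact: measurable_funM|exact: mabs].
  move=> x _; rewrite -EFinM -!EFinD lee_fin /h.
  have := ler_normD (g_ n x - f x) (- g_ n x); rewrite normrN addrAC subrr add0r normrN.
  have := ler_normD (f x) (g_ n x - f x); rewrite addrC subrK.
  have := ler_normB (g_ n x) (f x); have := normr_ge0 (g_ n x).
  by case: (leP `|f x| `|g_ n x - f x|); lra.
apply: (@squeeze_cvge _ _ _ _ (cst 0%E) _ (fun n => 2%:E * \int[mu]_x (h n x)%:E)%E).
- by apply: nearW => n; rewrite hle integral_ge0.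
- exact: cvg_cst.
- rewrite -[X in _ --> X](mule0 2%:E).
  by apply: cvgeZl => //.
Qed.

(** Points within 8^-n of the infimum form a fast Cauchy sequence: the midpoint value is at least
    the infimum, so strong convexity leaves at most 2 * 8^-n for c times the squared distance,
    whence the constant 2 / c. Lower semicontinuity is asked only along such sequences, which also
    converge almost everywhere. *)
Lemma L2_minimizer (F : (X -> R) -> \bar R) (c m0 : R) : 0 < c ->
  (exists2 u, u \in Lfun mu 2%:E & (F u < +oo)%E) ->
  (forall u, u \in Lfun mu 2%:E -> (m0%:E <= F u)%E) ->
  (forall u v, u \in Lfun mu 2%:E -> v \in Lfun mu 2%:E ->
    (2%:E * F (fun x => 2^-1 * (u x + v x))%R +
     c%:E * \int[mu]_x ((u x - v x) ^+ 2)%:E <= F u + F v)%E) ->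
  (forall (u_ : nat -> X -> R) u (a C : R), (forall n, u_ n \in Lfun mu 2%:E) ->
    u \in Lfun mu 2%:E -> {ae mu, forall x, u_ n x @[n --> \oo] --> u x} ->
    (forall n, (\int[mu]_x ((u x - u_ n x) ^+ 2)%:E <= (C * 8^-1 ^+ n)%:E)%E) ->
    (forall n, (F (u_ n) <= (a + 8^-1 ^+ n)%:E)%E) -> (F u <= a%:E)%E) ->
  exists2 u, u \in Lfun mu 2%:E &
    (F u < +oo)%E /\ forall v, v \in Lfun mu 2%:E -> (F u <= F v)%E.
Proof.
move=> c0 [u0 u0L Fu0] Fm0 Fconv Flsc.
pose m := ereal_inf (F @` [set u | u \in Lfun mu 2%:E]).
have mle u : u \in Lfun mu 2%:E -> (m <= F u)%E.
  by move=> uL; apply: ereal_inf_lbound; exists u.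
have mfin : m \is a fin_num.
  rewrite fin_numElt (lt_le_trans (ltNyr m0))/=.
    exact: le_lt_trans (mle _ u0L) Fu0.
  by apply: le_ereal_inf_tmp => _ [u uL <-]; exact: Fm0.
have e0 n : 0 < 8^-1 ^+ n :> R by rewrite exprn_gt0.
have /choice[u_ u_P] n : exists u, u \in Lfun mu 2%:E /\ (F u <= (fine m + 8^-1 ^+ n)%:E)%E.
  have [_ [u uL <-] ue] := lb_ereal_inf_adherent (e0 n) mfin.
  by exists u; split => //; rewrite EFinD fineK// ltW.
have uL n := (u_P n).1; have uF n := (u_P n).2.
have [|u uL2 [uu uC]] := @L2_complete _ _ _ mu u_ (2 / c) uL.
  move=> n k nk; have := Fconv _ _ (uL k) (uL n).
  have midL : (fun x => 2^-1 * (u_ k x + u_ n x)) \in Lfun mu 2%:E.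
    have -> : (fun x => 2^-1 * (u_ k x + u_ n x)) =
       (fun x => 2^-1 * u_ k x + (2^-1 * u_ n x + 0)).
      by apply/funext => x; rewrite addr0 mulrDr.
    have L0 : (fun=> 0) \in Lfun mu 2%:E by apply: (Lfun_submod_closed mu (lee1n 2)).1.
    by apply: (@Lfun_lin _ _ _ mu 2%:E (u_ k) (fun x => 2^-1 * u_ n x + 0) _ (lee1n 2)) => //;
      exact: (@Lfun_lin _ _ _ mu 2%:E (u_ n) (fun=> 0) _ (lee1n 2)).
  have m2 : ((2 * fine m)%:E <= 2%:E * F (fun x => (2^-1 * (u_ k x + u_ n x))%R))%E.
    by rewrite EFinM fineK// lee_pmul2l// mle.
  move=> h.
  have : ((2 * fine m)%:E + c%:E * \int[mu]_x ((u_ k x - u_ n x) ^+ 2)%:E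
          <= (2 * fine m + 2 * 8^-1 ^+ n)%:E)%E.
    apply: le_trans (leeD2r _ m2) _; apply: le_trans h _.
    apply: le_trans (leeD (uF k) (uF n)) _; rewrite -EFinD lee_fin.
    have : 8^-1 ^+ k <= 8^-1 ^+ n :> R by rewrite ler_wiXn2l//; lra.
    lra.
  rewrite EFinD leeD2lE// => {}h.
  rewrite -(@lee_pmul2l _ c%:E)//; apply: le_trans h _.
  by rewrite -EFinM lee_fin mulrA mulrCA divff ?mulr1// gt_eqF.
exists u => //; have Fum : (F u <= m)%E.
  by rewrite -(fineK mfin); exact: Flsc uL uL2 uu uC uF.
split; first by apply: le_lt_trans Fum _; rewrite ltey_eq mfin.
by move=> v vL; exact: le_trans Fum (mle _ vL).
Qed.

End L2_minimization.

(** * The resolvent equation *)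

Section energy.
Context d (X : measurableType d) (R : realType).
Variables (mu : {measure set X -> \bar R}) (E : (X -> R) -> \bar R).
Implicit Types u v w : X -> R.

Lemma Lfun2_le u v : measurable_fun setT u -> v \in Lfun mu 2%:E ->
  (forall x, `|u x| <= `|v x|) -> u \in Lfun mu 2%:E.
Proof.
move=> mu_ /Lfun2P[mv vi] uv; apply/Lfun2P; split => //.
apply: le_integrable vi => //.
  by apply/measurable_EFinP; exact: measurable_funX.
by move=> x _; rewrite lee_fin !normrX lerXn2r ?nnegrE.
Qed.

Lemma P0_measurable (T : R -> R) : P0 T -> measurable_fun setT T.
Proof. by move=> [Tc _ _ _ _]; exact: continuous_measurable_fun. Qed.

Lemma P0_norm_le (T : R -> R) s : P0 T -> `|T s| <= `|s|.
Proof.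
move=> PT; have [_ _ T0 _ _] := PT.
have [s0|/ltW s0] := leP 0 s; have := P0_nondecreasing PT s0; rewrite T0.
  by rewrite !subr0 => /andP[? ?]; rewrite !ger0_norm.
by rewrite !sub0r => /andP[? ?]; rewrite !ler0_norm// -oppr_ge0.
Qed.

Lemma P0_Lfun2 (T : R -> R) u : P0 T -> u \in Lfun mu 2%:E -> T \o u \in Lfun mu 2%:E.
Proof.
move=> PT uL; apply: (Lfun2_le _ uL) => [|x /=]; last exact: P0_norm_le.
by apply: measurableT_comp (P0_measurable PT) _; exact: Lfun_measurable uL.
Qed.

Lemma Lfun2B u v : u \in Lfun mu 2%:E -> v \in Lfun mu 2%:E -> (v - u)%R \in Lfun mu 2%:E.
Proof.
move=> uL vL; rewrite (_ : v - u = (fun x => -1 * u x + v x)).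
  by apply: (@Lfun_lin _ _ _ mu 2%:E u v _ (lee1n 2)).
by apply/funext => x; rewrite mulN1r addrC.
Qed.

Hypothesis E_proper : proper_functional mu E.
Hypothesis A0 : subgradient_part mu E (0, 0).
Hypothesis E_contr : forall (u v : X -> R) (T : R -> R),
  u \in Lfun mu 2%:E -> v \in Lfun mu 2%:E -> P0 T ->
  (E (u + (T \o (v - u)))%R + E (v - (T \o (v - u)))%R <= E u + E v)%E.

Lemma zero_Lfun2 : (0 : X -> R) \in Lfun mu 2%:E.
Proof. by have [[[]]] := A0. Qed.

Lemma E_fin_num u : u \in Lfun mu 2%:E -> (E u < +oo)%E -> E u \is a fin_num.
Proof. by move=> uL Eu; rewrite fin_numElt Eu E_proper.1. Qed.

Lemma E0_fin_num : E 0 \is a fin_num.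
Proof. by have [[[? ?] _ _] _] := A0; exact: E_fin_num. Qed.

Lemma E_min u : u \in Lfun mu 2%:E -> (E 0%R <= E u)%E.
Proof.
move=> uL; have [[_ _ /(_ u uL)]] := A0; rewrite /L2inner/=.
under eq_integral do rewrite mul0r.
by rewrite integral0 sube_ge0// E0_fin_num.
Qed.

Lemma E_shrink (T : R -> R) u : P0 T -> u \in Lfun mu 2%:E ->
  (E (u - (T \o u))%R <= E u)%E.
Proof.
move=> PT uL; have := E_contr zero_Lfun2 uL PT; rewrite add0r subr0 => h.
rewrite -(leeD2lE _ _ E0_fin_num); apply: le_trans h.
by rewrite leeD2r// E_min// P0_Lfun2.
Qed.

End energy.

Lemma ge0_le_integral_lin d (X : measurableType d) (R : realType)
  (mu : {measure set X -> \bar R}) (k c : R) (a b p q : X -> R) :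
  0 <= k -> 0 <= c ->
  measurable_fun setT a -> measurable_fun setT b ->
  measurable_fun setT p -> measurable_fun setT q ->
  (forall x, 0 <= a x) -> (forall x, 0 <= b x) -> (forall x, 0 <= p x) ->
  (forall x, 0 <= q x) -> (forall x, k * a x + c * b x <= p x + q x) ->
  (k%:E * \int[mu]_x (a x)%:E + c%:E * \int[mu]_x (b x)%:E <=
   \int[mu]_x (p x)%:E + \int[mu]_x (q x)%:E)%E.
Proof.
move=> k0 c0 ma mb mp mq a0 b0 p0 q0 le.
have nn (g : X -> R) : (forall x, 0 <= g x) -> forall x, [set: X] x -> (0 <= (g x)%:E)%E.
  by move=> g0 x _; rewrite lee_fin.
have mm (g : X -> R) : measurable_fun setT g -> measurable_fun setT (fun x => (g x)%:E).
  by move=> ?; exact/measurable_EFinP.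
rewrite -!ge0_integralZl_EFin//; try solve [exact: nn|exact: mm].
rewrite -!ge0_integralD//; try solve [exact: nn|exact: mm].
- apply: ge0_le_integral => //.
  + by move=> x _; rewrite -!EFinM -EFinD lee_fin addr_ge0// mulr_ge0.
  + by apply: emeasurable_funD; apply: measurable_funeM; exact: mm.
  + by apply: emeasurable_funD; exact: mm.
  + by move=> x _; rewrite -!EFinM -!EFinD lee_fin.
- by move=> x _; rewrite -EFinM lee_fin mulr_ge0.
- by apply: measurable_funeM; exact: mm.
- by move=> x _; rewrite -EFinM lee_fin mulr_ge0.
- by apply: measurable_funeM; exact: mm.
Qed.

(** * Existence of the minimizer *)

Section resolvent_minimizer.
Context d (X : measurableType d) (R : realType).
Variables (mu : {measure set X -> \bar R}) (E : (X -> R) -> \bar R).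
Implicit Types u v w : X -> R.
Hypothesis E_proper : proper_functional mu E.
Hypothesis E_lsc : lsc_functional mu E.
Hypothesis E_convex : convex_functional mu E.
Hypothesis A0 : subgradient_part mu E (0, 0).
Variables (b j : R -> R) (K delta : R) (f : X -> R).
Hypothesis bK : forall s, `|b s| <= K.
Hypothesis b0 : b 0 = 0.
Hypothesis j0 : j 0 = 0.
Hypothesis jb : forall r s, b r * (s - r) <= j s - j r.
Hypothesis delta0 : 0 < delta.
Hypothesis fL : f \in Lfun mu 2%:E.

(** Up to the term f^2 / (2 delta), which does not depend on [s], this is delta s^2 / 2 - f s +
    j(s), with formal derivative delta s - f + b(s). The completed square keeps it nonnegative. *)
Definition resolvent_density x s : R := (delta * s - f x) ^+ 2 / (2 * delta) + j s.
Local Notation N u := (fun x => resolvent_density x (u x)).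

Let j_ge0 s : 0 <= j s.
Proof. by have := jb 0 s; rewrite b0 mul0r j0 subr0. Qed.

Let j_lip r s : `|j s - j r| <= K * `|s - r|.
Proof.
have K0 : 0 <= K by apply: le_trans (bK 0).
have h1 : b s * (s - r) <= K * `|s - r|.
  by rewrite (le_trans (ler_norm _))// normrM ler_wpM2r.
have h2 : - (K * `|s - r|) <= b r * (s - r).
  by rewrite lerNl -mulNr (le_trans (ler_norm _))// normrM normrN ler_wpM2r.
rewrite ler_norml; have := jb r s; have := jb s r; lra.
Qed.

Lemma potential_continuous : continuous j.
Proof.
have K0 : 0 <= K by apply: le_trans (bK 0).
move=> r; apply/cvgrPdist_le => /= e e0; near=> s.
rewrite (le_trans (j_lip _ _))//.
rewrite (le_trans (_ : _ <= (K + 1) * `|r - s|))//.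
  by rewrite ler_wpM2r// lerDl.
rewrite -ler_pdivlMl ?ltr_wpDl//; near: s.
apply: cvgr_dist_le; first exact: cvg_id.
by rewrite mulr_gt0// invr_gt0 ltr_wpDl.
Unshelve. all: by end_near. Qed.

Let N_ge0 x s : 0 <= resolvent_density x s.
Proof. by rewrite addr_ge0// mulr_ge0 ?sqr_ge0// invr_ge0 mulr_ge0// ltW. Qed.

Let mf := Lfun_measurable fL.

Let mN u : u \in Lfun mu 2%:E -> measurable_fun setT (N u).
Proof.
move=> /Lfun_measurable mu_; apply: measurable_funD.
  apply: measurable_funM => //; apply: measurable_funX; apply: measurable_funB => //.
  exact: measurable_funM.
by apply: measurableT_comp => //; apply: continuous_measurable_fun potential_continuous.
Qed.

Let resolvent_density_continuous x : continuous (resolvent_density x).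
Proof.
move=> s; apply: cvgD; last exact: potential_continuous.
apply: cvgM; last exact: cvg_cst.
rewrite expr2; under eq_fun do rewrite expr2.
by apply: cvgM; (apply: cvgB; last exact: cvg_cst);
  (apply: cvgM; [exact: cvg_cst|exact: cvg_id]).
Qed.

Let F u := (delta%:E * E u + \int[mu]_x (N u x)%:E)%E.

Let IN_ge0 u : (0 <= \int[mu]_x (N u x)%:E)%E.
Proof. by apply: integral_ge0 => x _; rewrite lee_fin. Qed.

Lemma resolvent_minimizer : exists2 w, w \in Lfun mu 2%:E &
  [/\ (E w < +oo)%E, mu.-integrable setT (EFin \o N w) &
   forall v, v \in Lfun mu 2%:E -> (F w <= F v)%E].
Proof.
(* The modulus [delta / 4] is the exact defect in the parallelogram identity for the quadratic
   part. *)
have c0 : 0 < delta / 4 by rewrite divr_gt0.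
have de0 : (0 < delta%:E)%E by rewrite lte_fin.
have E0f := E0_fin_num E_proper A0.
have dE_gtNy u : u \in Lfun mu 2%:E -> (-oo < delta%:E * E u)%E.
  move=> uL; have := E_min E_proper A0 uL; rewrite -(lee_pmul2l _ de0)//; apply: lt_le_trans.
  by rewrite -(fineK E0f) -EFinM ltNyr.
have int_N0 : (\int[mu]_x (resolvent_density x 0)%:E < +oo)%E.
  have /Lfun2P[_ fi] := fL.
  have /integrableP[_] := integrableZl measurableT (2 * delta)^-1 fi.
  apply: le_lt_trans; rewrite le_eqVlt; apply/orP; left; apply/eqP.
  apply: eq_integral => x _; rewrite -EFinM /resolvent_density/= mulr0 sub0r sqrrN j0 addr0 mulrC.
  by rewrite ger0_norm// mulr_ge0 ?sqr_ge0// invr_ge0 mulr_ge0// ltW.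
have F0 : (F 0%R < +oo)%E by rewrite /F lte_add_pinfty// -(fineK E0f) -EFinM ltry.
have Fm0 u : u \in Lfun mu 2%:E -> ((delta * fine (E 0%R))%R%:E <= F u)%E.
  move=> uL; rewrite EFinM fineK// -[leLHS]adde0; apply: leeD => //.
  by have E0u := E_min E_proper A0 uL; rewrite lee_pmul2l.
have Fconv u v : u \in Lfun mu 2%:E -> v \in Lfun mu 2%:E ->
  (2%:E * F (fun x => 2^-1 * (u x + v x))%R +
     (delta / 4)%:E * \int[mu]_x ((u x - v x) ^+ 2)%:E <= F u + F v)%E.
  move=> uL vL.
  have midE : (fun x => 2^-1 * (u x + v x)) = 2^-1 *: u + (1 - 2^-1) *: v.
    by apply/funext => x; rewrite /= mulrDr; congr (_ + _ * _); lra.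
  have midL : (fun x => 2^-1 * (u x + v x)) \in Lfun mu 2%:E.
    have -> : (fun x => 2^-1 * (u x + v x)) =
        (fun x => 2^-1 * u x + (2^-1 * v x + 0)).
      by apply/funext => x; rewrite addr0 mulrDr.
    apply: (@Lfun_lin _ _ _ mu 2%:E u (fun x => 2^-1 * v x + 0) _ (lee1n 2)) => //.
    exact: (@Lfun_lin _ _ _ mu 2%:E v 0 _ (lee1n 2) vL (zero_Lfun2 A0)).
  have Emid : (2%:E * E (fun x => 2^-1 * (u x + v x))%R <= E u + E v)%E.
    have h : 0 <= (2^-1 : R) <= 1 by lra.
    have := E_convex uL vL h; rewrite -midE (_ : 1 - 2^-1 = 2^-1 :> R); last by lra.
    rewrite -muleDr//; last first.
      rewrite ltninfty_adde_def// inE E_proper.1//.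
    by move=> {}h; rewrite -(@lee_pmul2l _ 2^-1%:E)// muleA -EFinM mulVf// mul1e.
  have mDB : measurable_fun setT (fun x => ((u x - v x) ^+ 2)%:E).
    apply/measurable_EFinP; apply: measurable_funX.
    by apply: measurable_funB; [exact: Lfun_measurable uL|exact: Lfun_measurable vL].
  have IN : (2%:E * (\int[mu]_x (N (fun x => 2^-1 * (u x + v x))%R x)%:E) +
     (delta / 4)%:E * \int[mu]_x ((u x - v x) ^+ 2)%:E <=
      \int[mu]_x (N u x)%:E + \int[mu]_x (N v x)%:E)%E.
    apply: ge0_le_integral_lin => //; try exact: mN.
    - exact: ltW.
    - exact/measurable_EFinP.
    - by move=> x; exact: sqr_ge0.
    move=> x; rewrite /resolvent_density.
    have jm : 2 * j (2^-1 * (u x + v x)) <= j (u x) + j (v x).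
      have := jb (2^-1 * (u x + v x)) (u x); have := jb (2^-1 * (u x + v x)) (v x).
      by lra.
    have -> : 2 * ((delta * (2^-1 * (u x + v x)) - f x) ^+ 2 / (2 * delta) +
       j (2^-1 * (u x + v x))) + delta / 4 * (u x - v x) ^+ 2 =
       (delta * u x - f x) ^+ 2 / (2 * delta) + (delta * v x - f x) ^+ 2 / (2 * delta)
       + 2 * j (2^-1 * (u x + v x)) by field; rewrite gt_eqF.
    by lra.
  have IEmid : (2%:E * (delta%:E * E (fun x => 2^-1 * (u x + v x))%R) <=
      delta%:E * E u + delta%:E * E v)%E.
    rewrite -muleDr//; last by rewrite ltninfty_adde_def// inE E_proper.1.
    by rewrite muleCA lee_pmul2l.
  have -> : (F u + F v = (delta%:E * E u + delta%:E * E v) +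
      (\int[mu]_x (N u x)%:E + \int[mu]_x (N v x)%:E))%E by rewrite addeACA.
  rewrite {1}/F muleDr//; first by rewrite -addeA; exact: leeD IEmid IN.
  by rewrite ltninfty_adde_def// inE ?dE_gtNy// (lt_le_trans (ltNyr 0)).
have Flsc (u_ : nat -> X -> R) u (a C : R) : (forall n, u_ n \in Lfun mu 2%:E) ->
    u \in Lfun mu 2%:E -> {ae mu, forall x, u_ n x @[n --> \oo] --> u x} ->
    (forall n, (\int[mu]_x ((u x - u_ n x) ^+ 2)%:E <= (C * 8^-1 ^+ n)%:E)%E) ->
    (forall n, (F (u_ n) <= (a + 8^-1 ^+ n)%:E)%E) -> (F u <= a%:E)%E.
  move=> u_L uL uu uC Fa.
  have g0 : 8^-1 ^+ n @[n --> \oo] --> (0 : R).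
    by apply: cvg_expr; rewrite ger0_norm; lra.
  (* A level [al] below E(u) is eventually below E(u_n) as well, which leaves at most a - delta al,
     up to a small error, for the integral part; Fatou passes this to the limit. *)
  have key (al : R) : (al%:E < E u)%E ->
      (\int[mu]_x (N u x)%:E <= (a - delta * al)%:E)%E.
    move=> alE; have [e e0 Ee] := E_lsc uL alE.
    apply/lee_addgt0Pr => eta eta0.
    apply: (@fatou_ae _ _ _ mu (fun n => N (u_ n)) (N u)) => //.
    - by move=> n; exact: mN.
    - exact: mN.
    - apply: filterS uu => x ux.
      by apply: continuous_cvg ux; exact: resolvent_density_continuous.
    near=> n.
    have Eun : (al%:E < E (u_ n))%E.
      apply: Ee => //; apply: Lnorm2_lt => //.
      apply: (@le_lt_trans _ _ (C * 8^-1 ^+ n)%:E).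
        apply: le_trans (uC n); rewrite le_eqVlt; apply/orP; left; apply/eqP.
        by apply: eq_integral => x _; rewrite -sqrrN opprB.
      rewrite lte_fin; near: n; apply: (cvgr_lt (C * 0)); last by rewrite mulr0 exprn_gt0.
      by apply: cvgM => //; exact: cvg_cst.
    rewrite -(@leeD2lE _ (delta * al)%:E)//.
    apply: (@le_trans _ _ (F (u_ n))).
      by rewrite leeD2r// EFinM lee_pmul2l// ltW.
    apply: le_trans (Fa n) _; rewrite -!EFinD lee_fin.
    have : 8^-1 ^+ n < eta by near: n; exact: cvgr_lt g0 _ eta0.
    by lra.
  (* E(0) - 1 is a level below E(u) in any case, since 0 minimizes E. *)
  have : (\int[mu]_x (N u x)%:E)%E \is a fin_num.
    rewrite ge0_fin_numE//; apply: le_lt_trans (key (fine (E 0) - 1) _) (ltry _).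
    apply: lt_le_trans (E_min E_proper A0 uL).
    by rewrite -[ltRHS](fineK E0f) lte_fin; lra.
  case iE : (\int[mu]_x (N u x)%:E)%E key => [i||] // key _.
  (* Otherwise a level strictly between (a - i) / delta and E(u) would force the integral [i] to be
     smaller than itself. *)
  have Eu : (E u <= ((a - i) / delta)%:E)%E.
    rewrite leNgt; apply/negP.
    case EuE : (E u) key => [r||] key //; rewrite ?lte_fin.
      move=> h; have := key (((a - i) / delta + r) / 2); rewrite !lte_fin lee_fin.
      move: h; set t := (a - i) / delta => tr.
      have -> : a = delta * t + i by rewrite /t mulrC divfK ?gt_eqF// subrK.
      by move=> /(_ ltac:(lra)); nra.
    move=> _; have := key ((a - i) / delta + 1) (ltry _); rewrite lee_fin.
    by rewrite mulrDr mulrCA divff ?gt_eqF//; lra.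
  rewrite /F iE; apply: (@le_trans _ _ (delta%:E * ((a - i) / delta)%:E + i%:E)%E).
    by rewrite leeD2r// lee_pmul2l.
  by rewrite -EFinM -EFinD lee_fin mulrCA divff ?gt_eqF// mulr1 subrK.
have [||w wL [Fw Fmin]] := @L2_minimizer _ _ _ mu F _ _ c0 _ Fm0 Fconv.
- by exists 0; first exact: zero_Lfun2 A0.
- exact: Flsc.
exists w => //.
have dE := dE_gtNy _ wL.
split=> //.
- have := Fw; rewrite /F; case: (E w) dE => [r _ _||//]; first exact: ltry.
  rewrite gt0_muley//.
  by rewrite addye// gt_eqF// (lt_le_trans (ltNyr 0)).
- apply/integrableP; split; first by apply/measurable_EFinP; exact: mN.
  have := Fw; rewrite /F; under [X in _ -> (X < _)%E]eq_integral do rewrite gee0_abs ?lee_fin//.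
  case: (\int[mu]_x (N w x)%:E)%E (IN_ge0 w) => [r _ _|_|//]; first exact: ltry.
  by rewrite addey// gt_eqF.
Unshelve. all: by end_near. Qed.

End resolvent_minimizer.

Lemma Rintegral_le0_ae_eq0 d (X : measurableType d) (R : realType)
    (mu : {measure set X -> \bar R}) (g : X -> R) :
  mu.-integrable setT (EFin \o g) -> {ae mu, forall x, 0 <= g x} ->
  \int[mu]_x g x <= 0 -> {ae mu, forall x, g x = 0}.
Proof.
move=> gi g0 Ig; have mg : measurable_fun setT (EFin \o g) by exact: measurable_int gi.
have gE : (\int[mu]_x `|(EFin \o g) x| = \int[mu]_x (EFin \o g) x)%E.
  apply: ae_eq_integral => //; first exact: measurableT_comp.
  by apply: filterS g0 => x g0 _; rewrite gee0_abs ?lee_fin.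
have /(ae_eq_integral_abs mu measurableT mg) : (\int[mu]_x `|(EFin \o g) x| = 0)%E.
  apply/eqP; rewrite eq_le; apply/andP; split; last exact: integral_ge0.
  rewrite gE -(fineK (integrable_fin_num measurableT gi)) lee_fin.
  exact: Ig.
by apply: filterS => x /(_ I) [].
Qed.

(** * A priori bounds and Euler-Lagrange equation for the minimizer *)

Section resolvent.
Context d (X : measurableType d) (R : realType).
Variables (mu : {measure set X -> \bar R}) (E : (X -> R) -> \bar R).
Implicit Types u v : X -> R.
Hypothesis E_proper : proper_functional mu E.
Hypothesis E_convex : convex_functional mu E.
Hypothesis A0 : subgradient_part mu E (0, 0).
Hypothesis E_contr : forall (u v : X -> R) (T : R -> R),
  u \in Lfun mu 2%:E -> v \in Lfun mu 2%:E -> P0 T ->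
  (E (u + (T \o (v - u)))%R + E (v - (T \o (v - u)))%R <= E u + E v)%E.
Variables (b j : R -> R) (K M delta : R) (f : X -> R).
Hypothesis b_cont : continuous b.
Hypothesis b_nd : {homo b : x y / x <= y}.
Hypothesis bK : forall s, `|b s| <= K.
Hypothesis b0 : b 0 = 0.
Hypothesis j0 : j 0 = 0.
Hypothesis jb : forall r s, b r * (s - r) <= j s - j r.
Hypothesis delta0 : 0 < delta.
Hypothesis M0 : 0 < M.
Hypothesis f1oo : L1capLoo mu f.
Hypothesis fM : {ae mu, forall x, b (- M) <= f x <= b M}.
Local Notation N u := (fun x => resolvent_density j delta f x (u x)).
Variable w : X -> R.
Hypothesis wL : w \in Lfun mu 2%:E.
Hypothesis Ew : (E w < +oo)%E.
Hypothesis Nw : mu.-integrable setT (EFin \o N w).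
Hypothesis w_min : forall v, v \in Lfun mu 2%:E ->
  (delta%:E * E w + \int[mu]_x (N w x)%:E <= delta%:E * E v + \int[mu]_x (N v x)%:E)%E.

Let fL : f \in Lfun mu 2%:E := L1capLoo_Lfun2 f1oo.
Let mf := Lfun_measurable fL.
Let mw := Lfun_measurable wL.
Let mb : measurable_fun setT b := continuous_measurable_fun b_cont.

Let mbu u : measurable_fun setT u -> measurable_fun setT (fun x => b (u x)).
Proof. by move=> ?; exact: measurableT_comp. Qed.

Let j_ge0 s : 0 <= j s.
Proof. by have := jb 0 s; rewrite b0 mul0r j0 subr0. Qed.

Let N_ge0 x s : 0 <= resolvent_density j delta f x s.
Proof. by rewrite addr_ge0// mulr_ge0 ?sqr_ge0// invr_ge0 mulr_ge0// ltW. Qed.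

Let N_le x s r : resolvent_density j delta f x s <=
  resolvent_density j delta f x r + (delta * s - f x + b s) * (s - r).
Proof.
rewrite /resolvent_density; have := jb s r.
set A := delta * s - f x; set B := delta * r - f x.
have sr : s - r = (A - B) / delta by rewrite /A /B; field; rewrite gt_eqF.
suff : A ^+ 2 / (2 * delta) - B ^+ 2 / (2 * delta) <= A * (s - r) by lra.
rewrite sr -subr_ge0.
have -> : A * ((A - B) / delta) - (A ^+ 2 / (2 * delta) - B ^+ 2 / (2 * delta))
  = (A - B) ^+ 2 / (2 * delta) by field; rewrite gt_eqF.
by rewrite divr_ge0 ?sqr_ge0// mulr_ge0// ltW.
Qed.

(** The derivative of the density is taken at the competitor [v], not at [w]: convexity bounds N(v)
    by N(w) + q, so integrability of [q] already makes N(v) integrable and no difference quotient is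
    formed. *)
Lemma minimizer_variational v :
  let q x := (delta * v x - f x + b (v x)) * (v x - w x) in
  v \in Lfun mu 2%:E -> (E v < +oo)%E -> mu.-integrable setT (EFin \o q) ->
  0 <= delta * (fine (E v) - fine (E w)) + \int[mu]_x q x.
Proof.
move=> q vL Ev qi.
have mN : measurable_fun setT (N v).
  have mv := Lfun_measurable vL.
  apply: measurable_funD.
    apply: measurable_funM => //; apply: measurable_funX; apply: measurable_funB => //.
    exact: measurable_funM.
  apply: measurableT_comp => //; apply: continuous_measurable_fun.
  exact: potential_continuous bK jb.
have sumi := integrableD measurableT Nw qi.
have Nvi : mu.-integrable setT (EFin \o N v).
  apply: le_integrable sumi => //; first exact/measurable_EFinP.
  move=> x _; rewrite /= lee_fin ger0_norm//.
  by apply: le_trans (ler_norm _); exact: N_le.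
have := w_min vL.
rewrite -(fineK (E_fin_num E_proper vL Ev)) -(fineK (E_fin_num E_proper wL Ew)).
rewrite -(fineK (integrable_fin_num measurableT Nw)) -(fineK (integrable_fin_num measurableT Nvi)).
rewrite -!EFinM -!EFinD lee_fin -/(Rintegral mu setT (N w)) -/(Rintegral mu setT (N v)).
have : \int[mu]_x N v x <= \int[mu]_x (N w x + q x).
  by apply: le_Rintegral => // x _; exact: N_le.
rewrite RintegralD//; lra.
Qed.

Let shrink_sign (T : R -> R) s : P0 T ->
  (0 <= s /\ 0 <= T s <= s) \/ (s <= 0 /\ s <= T s <= 0).
Proof.
move=> PT; have [_ _ T0 _ _] := PT.
have [s0|/ltW s0] := leP 0 s; [left|right]; split => //;
  have := P0_nondecreasing PT s0; rewrite T0; lra.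
Qed.

(** For the competitor w - T(w) the energy difference is nonpositive, so E disappears and an
    inequality between integrals of pointwise expressions remains. *)
Lemma shrink_test (T : R -> R) : P0 T ->
  let q x := (delta * (w x - T (w x)) + b (w x - T (w x)) - f x) * T (w x) in
  mu.-integrable setT (EFin \o q) /\ \int[mu]_x q x <= 0.
Proof.
move=> PT q; pose v := w - (T \o w).
have TL : T \o w \in Lfun mu 2%:E by exact: P0_Lfun2.
have vL : v \in Lfun mu 2%:E by exact: Lfun2B.
have mT : measurable_fun setT (T \o w) := Lfun_measurable TL.
have mv : measurable_fun setT v := Lfun_measurable vL.
(* With v = w - T(w), the product is b(v) (w - v) <= j(w) - j(v) <= j(w) <= N(w). It is nonnegative
   because v and T(w) both have the sign of w. *)
have bTi : mu.-integrable setT (EFin \o (fun x => b (v x) * T (w x))).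
  apply: le_integrable Nw => //.
    by apply/measurable_EFinP; apply: measurable_funM => //; exact: mbu.
  move=> x _; rewrite lee_fin [leRHS]ger0_norm//.
  have jj : j (w x) <= resolvent_density j delta f x (w x).
    by rewrite lerDr divr_ge0 ?sqr_ge0// mulr_ge0// ltW.
  apply: le_trans jj; rewrite ger0_norm.
    have := jb (v x) (w x); have := j_ge0 (v x); rewrite /v !fctE/=.
    by lra.
  have -> : v x = w x - T (w x) by [].
  have [[s0 /andP[t0 t1]]|[s0 /andP[t0 t1]]] := shrink_sign (w x) PT.
    by rewrite mulr_ge0// -b0 b_nd// subr_ge0.
  by rewrite mulr_le0// -b0 b_nd// subr_le0.
have qi : mu.-integrable setT (EFin \o q).
  have dvi := integrableZl measurableT delta (Lfun2_integrableM vL TL).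
  have fTi := Lfun2_integrableM fL TL.
  have := integrableB measurableT (integrableD measurableT dvi bTi) fTi.
  apply: eq_integrable => // x _ /=.
  by rewrite -!EFinM -!EFinD; congr (_%:E); rewrite /q /v !fctE/=; ring.
split => //.
have Ev : (E v <= E w)%E by exact: (E_shrink E_proper A0 E_contr PT wL).
have Evoo := le_lt_trans Ev Ew.
have qN : (fun x => (delta * v x - f x + b (v x)) * (v x - w x)) = (fun x => - q x).
  by apply/funext => x; rewrite /q /v !fctE/=; ring.
have qNi : mu.-integrable setT (EFin \o (fun x => - q x)).
  exact: (integrableN qi).
have := @minimizer_variational v vL Evoo; rewrite /= qN => /(_ qNi).
have -> : \int[mu]_x (- q x) = - \int[mu]_x q x.
  under eq_Rintegral do rewrite -mulN1r; rewrite RintegralZl// mulN1r//.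
have : fine (E v) <= fine (E w).
  by rewrite fine_le// (E_fin_num E_proper).
by move: delta0; nra.
Qed.

(** Where w > M, also w - T(w) >= M, because T vanishes at [M] and is 1-Lipschitz. Hence b(w - T(w))
    >= b(M) >= f, and the tested integrand is at least delta M T(w) > 0 there. Its integral being
    nonpositive, this set is null; the lower bound is symmetric. *)
Lemma resolvent_bounded : {ae mu, forall x, `|w x| <= M}.
Proof.
have PR : P0 (soft_step (M + 1) 1 : R -> R) by exact: soft_step_P0.
have PL : P0 (soft_step (- (M + 1)) 1 : R -> R) by exact: soft_step_P0.
have R0 : {ae mu, forall x, w x <= M}.
  have [qi qle] := shrink_test PR; set q := (X in EFin \o X) in qi qle.
  have q0 : {ae mu, forall x, delta * M * soft_step (M + 1) 1 (w x) <= q x}.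
    apply: filterS fM => x /andP[_ fbM]; rewrite /q.
    have [wM|wM] := leP (w x) M.
      by rewrite (soft_step_right _ (ltW M0)).1// !mulr0.
    have T0 := (soft_step_right (w x) (ltW M0)).2 wM.
    rewrite ler_wpM2r ?(ltW T0)//.
    have := P0_nondecreasing PR (ltW wM).
    rewrite (soft_step_right M (ltW M0)).1// subr0 => /andP[_ ?].
    have Mv : M <= w x - soft_step (M + 1) 1 (w x) by lra.
    by have := b_nd Mv; have := ler_wpM2l (ltW delta0) Mv; lra.
  have T0 x : 0 <= soft_step (M + 1) 1 (w x).
    have [wM|wM] := leP (w x) M; first by rewrite (soft_step_right _ (ltW M0)).1.
    exact: ltW ((soft_step_right (w x) (ltW M0)).2 wM).
  have dM : 0 < delta * M by rewrite mulr_gt0.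
  have qge0 : {ae mu, forall x, 0 <= q x}.
    by apply: filterS q0 => x; apply: le_trans; rewrite mulr_ge0// ltW.
  have qz := Rintegral_le0_ae_eq0 qi qge0 qle.
  apply: filterS2 q0 qz => x + qz; rewrite {}qz pmulr_rle0// leNgt => /negP h.
  by rewrite leNgt; apply/negP => /(soft_step_right (w x) (ltW M0)).2.
have L0 : {ae mu, forall x, - M <= w x}.
  have [qi qle] := shrink_test PL; set q := (X in EFin \o X) in qi qle.
  have q0 : {ae mu, forall x, - (delta * M) * soft_step (- (M + 1)) 1 (w x) <= q x}.
    apply: filterS fM => x /andP[fbM _]; rewrite /q.
    have [wM|wM] := leP (- M) (w x).
      by rewrite (soft_step_left _ (ltW M0)).1// !mulr0.
    have T0 := (soft_step_left (w x) (ltW M0)).2 wM.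
    rewrite ler_wnM2r ?(ltW T0)//.
    have := P0_nondecreasing PL (ltW wM).
    rewrite (soft_step_left (- M) (ltW M0)).1// sub0r => /andP[_ ?].
    have Mv : w x - soft_step (- (M + 1)) 1 (w x) <= - M by lra.
    by have := b_nd Mv; have := ler_wpM2l (ltW delta0) Mv; lra.
  have T0 x : soft_step (- (M + 1)) 1 (w x) <= 0.
    have [wM|wM] := leP (- M) (w x); first by rewrite (soft_step_left _ (ltW M0)).1.
    exact: ltW ((soft_step_left (w x) (ltW M0)).2 wM).
  have dM : 0 < delta * M by rewrite mulr_gt0.
  have qge0 : {ae mu, forall x, 0 <= q x}.
    by apply: filterS q0 => x; apply: le_trans; rewrite mulr_le0// oppr_le0 ltW.
  have qz := Rintegral_le0_ae_eq0 qi qge0 qle.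
  apply: filterS2 q0 qz => x + qz; rewrite {}qz mulNr oppr_le0 pmulr_rge0// leNgt => /negP h.
  by rewrite leNgt; apply/negP => /(soft_step_left (w x) (ltW M0)).2.
by apply: filterS2 R0 L0 => x ? ?; rewrite ler_norml; apply/andP.
Qed.

(** Thus an L^1 bound on the sum bounds both terms. *)
Let same_sign s : `|delta * s + b s| = `|delta * s| + `|b s|.
Proof.
have [s0|/ltW s0] := leP 0 s.
  have bs := b_nd s0; rewrite b0 in bs.
  have ds : 0 <= delta * s by rewrite mulr_ge0// ltW.
  by rewrite !ger0_norm ?addr_ge0.
have bs := b_nd s0; rewrite b0 in bs.
have ds : delta * s <= 0 by rewrite mulr_ge0_le0// ltW.
by rewrite !ler0_norm ?opprD// -oppr_ge0 opprD addr_ge0// oppr_ge0.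
Qed.

Lemma resolvent_L1_bound :
  (\int[mu]_x `|(delta * w x + b (w x))%:E| <= \int[mu]_x `|(f x)%:E|)%E.
Proof.
pose e n : R := 2^-1 ^+ n.
have e0 n : 0 < e n by rewrite exprn_gt0.
have ecvg : e n @[n --> \oo] --> 0 by apply: cvg_expr; rewrite ger0_norm; lra.
pose T n := soft_step 0 (e n).
have PT n : P0 (T n) by exact: soft_step_P0.
(* The part of the tested integrand without [f]; it is nonnegative because both factors have the
   sign of [w x]. *)
pose p n x := (delta * (w x - T n (w x)) + b (w x - T n (w x))) * T n (w x).
have p_ge0 n x : 0 <= p n x.
  rewrite /p; have [[s0 /andP[t0 t1]]|[s0 /andP[t0 t1]]] := shrink_sign (w x) (PT n).
    have v0 : 0 <= w x - T n (w x) by rewrite subr_ge0.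
    by rewrite mulr_ge0// addr_ge0 ?mulr_ge0 ?(ltW delta0)// -b0 b_nd.
  have v0 : w x - T n (w x) <= 0 by rewrite subr_le0.
  rewrite mulr_le0// -oppr_ge0 opprD addr_ge0// oppr_ge0 ?mulr_ge0_le0 ?(ltW delta0)//.
  by rewrite -b0 b_nd.
have mT n : measurable_fun setT (fun x => T n (w x)).
  by apply: measurableT_comp => //; exact: P0_measurable.
have mv n : measurable_fun setT (fun x => w x - T n (w x)) by exact: measurable_funB.
have mp n : measurable_fun setT (p n).
  apply: measurable_funM => //; apply: measurable_funD; last exact: mbu.
  exact: measurable_funM.
have fi : mu.-integrable setT (EFin \o f) by apply/Lfun1_integrable; exact: f1oo.1.
(* The factor 2 / e_n normalizes T_n to an approximate sign: 2 T_n(w) / e_n equals the sign of w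
   once e_n <= |w|, and is bounded by 1 in absolute value, so the right-hand side stays below the
   L^1 norm of f. *)
apply: (@fatou_ae _ _ _ mu (fun n x => (2 / e n) * p n x)) => //.
- by move=> n; exact: measurable_funM.
- apply: measurableT_comp => //; apply: measurable_funD; last exact: mbu.
  exact: measurable_funM.
- by move=> n x; rewrite mulr_ge0// divr_ge0// ltW.
- apply: nearW => x; have [w0|w0] := eqVneq (w x) 0.
    rewrite w0 mulr0 b0 addr0 normr0.
    have pz n : 2 / e n * p n x = 0.
      by have [_ _ T0 _ _] := PT n; rewrite /p w0 T0 mulr0 mulr0.
    by under eq_fun do rewrite pz; exact: cvg_cst.
  have -> : `|delta * w x + b (w x)| = (delta * w x + b (w x)) * Num.sg (w x).
    have [s0|s0|s0] := sgrP (w x); last 2 first.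
    - rewrite mulr1 ger0_norm//; have := b_nd (ltW s0); rewrite b0 => ?.
      by rewrite addr_ge0// mulr_ge0// ltW.
    - rewrite mulrN1 ler0_norm//; have := b_nd (ltW s0); rewrite b0 => ?.
      have : delta * w x <= 0 by rewrite mulr_ge0_le0// ltW.
      by lra.
    - by rewrite s0 eqxx in w0.
  pose v n := w x - e n / 2 * Num.sg (w x).
  have vcvg : v n @[n --> \oo] --> w x.
    rewrite -[X in _ --> X](subr0 (w x)); apply: cvgB; first exact: cvg_cst.
    rewrite -[X in _ --> X](mul0r (Num.sg (w x))); apply: cvgM; last exact: cvg_cst.
    by rewrite -[X in _ --> X](mul0r 2^-1); apply: cvgM => //; exact: cvg_cst.
  apply: (@cvg_trans _ ((delta * v n + b (v n)) * Num.sg (w x) @[n --> \oo])).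
    apply: near_eq_cvg; near=> n.
    have ew : e n <= `|w x|.
      by near: n; apply: (cvgr_le 0 ecvg); rewrite normr_gt0.
    rewrite /p /T (soft_step_sign (e0 n) ew) -/(v n); field.
    by rewrite gt_eqF.
  apply: cvgM; last exact: cvg_cst.
  apply: cvgD; first by apply: cvgM => //; exact: cvg_cst.
  by apply: continuous_cvg vcvg; exact: b_cont.
- apply: nearW => n.
  have [qi qle] := shrink_test (PT n); set q := (X in EFin \o X) in qi qle.
  have fTi := Lfun2_integrableM fL (P0_Lfun2 (PT n) wL).
  have pE : p n = (fun x => q x + f x * T n (w x)).
    by apply/funext => x; rewrite /p /q -/(T n); ring.
  have pi : mu.-integrable setT (EFin \o p n).
    by rewrite pE; exact: (integrableD measurableT qi fTi).
  under eq_integral do rewrite EFinM.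
  rewrite ge0_integralZl_EFin//; last 3 first.
  + by move=> x _; rewrite lee_fin.
  + exact/measurable_EFinP.
  + by rewrite divr_ge0// ltW.
  have Ip : (\int[mu]_x (p n x)%:E <= (e n / 2)%:E * \int[mu]_x `|(f x)%:E|)%E.
    apply: (@le_trans _ _ (\int[mu]_x (f x * T n (w x))%:E)%E).
      rewrite -(fineK (integrable_fin_num measurableT pi)).
      rewrite -(fineK (integrable_fin_num measurableT fTi)) lee_fin.
      have : \int[mu]_x p n x = \int[mu]_x q x + \int[mu]_x (f x * T n (w x)).
        by rewrite pE RintegralD.
      rewrite /Rintegral => ->; move: qle; rewrite /Rintegral; lra.
    rewrite -ge0_integralZl_EFin//; last 2 first.
    + by apply: measurableT_comp => //; exact/measurable_EFinP.
    + by rewrite divr_ge0// ltW.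
    apply: le_integral => //.
      by apply: integrableZl => //; exact: integrable_abse.
    move=> x _; rewrite /= lee_fin mulrC.
    rewrite (le_trans (ler_norm _))// normrM ler_wpM2r//; exact: soft_step_bound.
  apply: (@le_trans _ _ ((2 / e n)%:E * ((e n / 2)%:E * \int[mu]_x `|(f x)%:E|))%E).
    by rewrite lee_pmul2l// lte_fin divr_gt0.
  rewrite muleA -EFinM (_ : 2 / e n * (e n / 2) = 1) ?mul1e//.
  by field; rewrite gt_eqF.
Unshelve. all: by end_near. Qed.

Let mwb : measurable_fun setT (fun x => delta * w x + b (w x)).
Proof. by apply: measurable_funD; [exact: measurable_funM|exact: mbu]. Qed.

Let wb_int : mu.-integrable setT (EFin \o (fun x => delta * w x + b (w x))).
Proof.
apply/integrableP; split; first exact/measurable_EFinP.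
apply: le_lt_trans resolvent_L1_bound _.
by have /Lfun1_integrable/integrableP[] := f1oo.1.
Qed.

Lemma resolvent_L1_contraction :
  (\int[mu]_x `|(b (w x))%:E| <= \int[mu]_x `|(f x)%:E|)%E.
Proof.
apply: le_trans resolvent_L1_bound; apply: ge0_le_integral => //.
- by apply: measurableT_comp => //; apply/measurable_EFinP; exact: mbu.
- by apply: measurableT_comp => //; exact/measurable_EFinP.
- by move=> x _; rewrite lee_fin same_sign lerDr.
Qed.

Lemma resolvent_L1capLoo : L1capLoo mu w.
Proof.
split; last by apply/LfunooP; split => //; exists M; exact: resolvent_bounded.
apply/Lfun1_integrable; apply: le_integrable (integrableZl measurableT delta^-1 wb_int) => //.
  exact/measurable_EFinP.
move=> x _; rewrite /= lee_fin normrM ger0_norm ?invr_ge0 ?(ltW delta0)//.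
by rewrite ler_pdivlMl// same_sign normrM (gtr0_norm delta0) lerDl.
Qed.

Lemma resolvent_L1capLoo_comp : L1capLoo mu (b \o w).
Proof.
split; last first.
  by apply/LfunooP; split; [exact: mbu|exists K; apply: nearW => x; exact: bK].
apply/Lfun1_integrable; apply: le_integrable wb_int => //.
  by apply/measurable_EFinP; exact: mbu.
by move=> x _; rewrite /= lee_fin same_sign lerDr.
Qed.

Let h x := delta^-1 * (f x - delta * w x - b (w x)).

Let hL : L1capLoo mu h.
Proof.
have -> : h = (fun x => delta^-1 * (-1 * (delta * w x + (b \o w) x) + f x) + 0).
  by apply/funext => x; rewrite /h/=; ring.
apply: (@L1capLoo_lin _ _ _ mu (fun x => -1 * (delta * w x + (b \o w) x) + f x) (fun=> 0)).
  apply: (@L1capLoo_lin _ _ _ mu (fun x => delta * w x + (b \o w) x)) => //.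
  by apply: L1capLoo_lin; [exact: resolvent_L1capLoo|exact: resolvent_L1capLoo_comp].
by have [_ []] := A0.
Qed.

(** Competitors t v + (1 - t) w with t -> 0 linearize the variational inequality. The derivative is
    taken at the moving point, where b is only known to be bounded, so v - w in L^1 supplies the
    domination. *)
Let subgradient_L1 v : v \in Lfun mu 2%:E -> v \in Lfun mu 1%E -> (E v < +oo)%E ->
  \int[mu]_x (h x * (v x - w x)) <= fine (E v) - fine (E w).
Proof.
move=> vL v1 Ev.
pose t n : R := 2^-1 ^+ n.
have t0 n : 0 < t n by rewrite exprn_gt0.
have t1 n : t n <= 1 by rewrite exprn_ile1//; lra.
have tcvg : t n @[n --> \oo] --> 0 by apply: cvg_expr; rewrite ger0_norm; lra.
pose v_ n x := t n * v x + (1 - t n) * w x.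
have vw1 : (fun x => v x - w x) \in Lfun mu 1%E.
  have -> : (fun x => v x - w x) = (fun x => -1 * w x + v x).
    by apply/funext => x; ring.
  by apply: Lfun_lin => //; exact: resolvent_L1capLoo.1.
have vw2 : (fun x => v x - w x) \in Lfun mu 2%:E by exact: Lfun2B.
have mvw := Lfun_measurable vw2; have mv := Lfun_measurable vL.
have v_L n : v_ n \in Lfun mu 2%:E.
  have -> : v_ n = (fun x => t n * (v x - w x) + w x).
    by apply/funext => x; rewrite /v_; ring.
  exact: (@Lfun_lin _ _ _ mu 2%:E _ _ _ (lee1n 2)).
have mv_ n := Lfun_measurable (v_L n).
pose r n x := (delta * v_ n x - f x + b (v_ n x)) * (v x - w x).
pose r' x := (delta * w x - f x + b (w x)) * (v x - w x).
(* Uniform in [n], since |v_n| <= |w| + |v| and |b| <= K. *)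
pose D x := delta * `|w x * (v x - w x)| + delta * `|v x * (v x - w x)|
  + `|f x * (v x - w x)| + K * `|v x - w x|.
have Di : mu.-integrable setT (EFin \o D).
  have iw := integrable_norm (Lfun2_integrableM wL vw2).
  have iv := integrable_norm (Lfun2_integrableM vL vw2).
  have i_f := integrable_norm (Lfun2_integrableM fL vw2).
  have ivw := integrable_norm (proj1 (Lfun1_integrable _ _) vw1).
  have := integrableD measurableT (integrableD measurableT (integrableD measurableT
    (integrableZl measurableT delta iw) (integrableZl measurableT delta iv)) i_f)
    (integrableZl measurableT K ivw).
  exact: eq_integrable.
have rD n x : `|r n x| <= D x.
  have vb : `|v_ n x| <= `|w x| + `|v x|.
    rewrite /v_ (le_trans (ler_normD _ _))// !normrM.
    rewrite (gtr0_norm (t0 n)) (@ger0_norm _ (1 - t n)) ?subr_ge0//.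
    by have := normr_ge0 (w x); have := normr_ge0 (v x); have := t1 n; have := t0 n; nra.
  rewrite /r /D !normrM.
  have -> : delta * (`|w x| * `|v x - w x|) + delta * (`|v x| * `|v x - w x|) +
    `|f x| * `|v x - w x| = (delta * (`|w x| + `|v x|) + `|f x|) * `|v x - w x| by ring.
  rewrite -mulrDl ler_wpM2r// (le_trans (ler_normD _ _))// lerD//.
  rewrite (le_trans (ler_normB _ _))// lerD2r normrM (gtr0_norm delta0).
  by rewrite ler_pM2l.
have mr n : measurable_fun setT (r n).
  apply: measurable_funM => //; apply: measurable_funD; last exact: mbu.
  by apply: measurable_funB => //; exact: measurable_funM.
have ri n : mu.-integrable setT (EFin \o r n).
  apply: le_integrable Di => //; first exact/measurable_EFinP.
  by move=> x _; rewrite /= lee_fin (le_trans (rD n x))// ler_norm.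
have vE n : v_ n = t n *: v + (1 - t n) *: w by [].
have Ev_ n : (E (v_ n) <= (t n * fine (E v) + (1 - t n) * fine (E w))%:E)%E.
  have tn : 0 <= t n <= 1 by rewrite (ltW (t0 n)) t1.
  have := E_convex vL wL tn; rewrite -vE.
  by rewrite -{1}(fineK (E_fin_num E_proper vL Ev)) -{1}(fineK (E_fin_num E_proper wL Ew)).
have rge n : ((- (delta * (fine (E v) - fine (E w))))%:E <= \int[mu]_x (r n x)%:E)%E.
  have Ev_oo : (E (v_ n) < +oo)%E := le_lt_trans (Ev_ n) (ltry _).
  have qE : (fun x => (delta * v_ n x - f x + b (v_ n x)) * (v_ n x - w x))
      = (fun x => t n * r n x).
    by apply/funext => x; rewrite /r /v_; ring.
  have := @minimizer_variational (v_ n) (v_L n) Ev_oo; rewrite /= qE.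
  have tri : mu.-integrable setT (EFin \o (fun x => t n * r n x)).
    exact: (integrableZl measurableT (t n) (ri n)).
  move=> /(_ tri); rewrite RintegralZl//.
  have : fine (E (v_ n)) <= t n * fine (E v) + (1 - t n) * fine (E w).
    by rewrite -lee_fin fineK// (E_fin_num E_proper).
  rewrite -(fineK (integrable_fin_num measurableT (ri n))) lee_fin.
  rewrite -/(Rintegral mu setT (r n)).
  set I := Rintegral _ _ _; set a := fine (E (v_ n)).
  set c := fine (E v); set c' := fine (E w) => ha hb.
  (* Convexity bounds E(v_n) - E(w) by t (E(v) - E(w)), and v_n - w = t (v - w), so a positive
     factor t cancels. *)
  have : 0 <= t n * (delta * (c - c') + I).
    apply: le_trans hb _; have := ler_wpM2l (ltW delta0) ha; lra.
  by rewrite pmulr_rge0//; lra.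
have [|||||r'i _ rcvg] := @dominated_convergence _ _ _ mu setT measurableT
   (fun n x => (r n x)%:E) (fun x => (r' x)%:E) (fun x => (D x)%:E).
- by move=> n; exact/measurable_EFinP.
- apply/measurable_EFinP; apply: measurable_funM => //; apply: measurable_funD; last exact: mbu.
  by apply: measurable_funB => //; exact: measurable_funM.
- apply: nearW => x _; apply: cvg_EFin; first exact: nearW.
  have vcvg : v_ n x @[n --> \oo] --> w x.
    rewrite -[X in _ --> X](_ : 0 * v x + (1 - 0) * w x = w x); last by ring.
    apply: cvgD; apply: cvgM; try exact: cvg_cst; first exact: tcvg.
    by apply: cvgB => //; exact: cvg_cst.
  apply: cvgM; last exact: cvg_cst.
  apply: cvgD; last by apply: continuous_cvg vcvg; exact: b_cont.
  apply: cvgB; last exact: cvg_cst.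
  by apply: cvgM => //; exact: cvg_cst.
- exact: Di.
- by apply: nearW => x n _; rewrite lee_fin.
have r'ge : ((- (delta * (fine (E v) - fine (E w))))%:E <= \int[mu]_x (r' x)%:E)%E.
  move/cvg_lim : (rcvg) => <-//; apply: lime_ge; last exact: nearW.
  by apply/cvg_ex; eexists; exact: rcvg.
move: r'ge; rewrite -(fineK (integrable_fin_num measurableT r'i)) lee_fin.
rewrite -/(Rintegral mu setT r').
have -> : (fun x => h x * (v x - w x)) = (fun x => - delta^-1 * r' x).
  by apply/funext => x; rewrite /h /r'; ring.
rewrite RintegralZl// mulNr => ?.
by rewrite -(ler_pM2l delta0) mulrN mulrA divff ?gt_eqF// mul1r; lra.
Qed.

(** It remains to leave L^1. Lower semicontinuity gives no upper bound on E at an arbitrary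
    approximation of [v], so the approximation must be one that does not raise E; [E_shrink]
    provides it, and [h] in L^1 absorbs the uniform error. *)
Lemma resolvent_subgradient : subgradient_part mu E (w, h).
Proof.
split; last by split => //; exact: resolvent_L1capLoo.
have hL2 := L1capLoo_Lfun2 hL.
split => //= v vL; rewrite /L2inner.
have wfin := E_fin_num E_proper wL Ew.
have [Ev|] := ltP (E v) +oo%E; last first.
  by rewrite leye_eq => /eqP ->; rewrite -(fineK wfin) -EFinN addye// leey.
have vfin := E_fin_num E_proper vL Ev.
have hvw := Lfun2_integrableM hL2 (Lfun2B wL vL).
rewrite -(fineK (integrable_fin_num measurableT hvw)) -(fineK vfin) -(fineK wfin).
rewrite -EFinB lee_fin -/(Rintegral mu setT (fun x => h x * (v - w) x)).
pose H := \int[mu]_x `|h x|.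
have h1 : mu.-integrable setT (EFin \o h) by apply/Lfun1_integrable; exact: hL.1.
have H0 : 0 <= H by exact: Rintegral_ge0.
apply/ler_addgt0Pr => eta eta0.
(* Chosen so that the uniform error e / 2 times the L^1 norm [H] stays below [eta]; the [+ 1] covers
   [H = 0]. *)
pose e := 2 * eta / (H + 1).
have e0 : 0 < e by rewrite divr_gt0 ?mulr_gt0// ltr_wpDl.
have PT : P0 (soft_step 0 e) by exact: soft_step_P0.
(* Soft thresholding brings [v] into L^1 at the cost of an L^oo error e / 2. *)
pose v' := v - (soft_step 0 e \o v).
have v'L : v' \in Lfun mu 2%:E by apply: Lfun2B => //; exact: P0_Lfun2.
have v'1 : v' \in Lfun mu 1%E.
  apply/Lfun1_integrable; have /Lfun2P[_ v2] := vL.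
  apply: le_integrable (integrableZl measurableT (2 * e)^-1 v2) => //.
    by apply/measurable_EFinP; exact: Lfun_measurable v'L.
  move=> x _; rewrite /= lee_fin mulrC [leRHS]ger0_norm; first exact: soft_step_quadratic.
  by rewrite divr_ge0 ?sqr_ge0// mulr_ge0// ltW.
have Ev'v : (E v' <= E v)%E by exact: (E_shrink E_proper A0 E_contr PT vL).
have Ev' := le_lt_trans Ev'v Ev.
have := subgradient_L1 v'L v'1 Ev'.
have fv : fine (E v') <= fine (E v) by rewrite fine_le// (E_fin_num E_proper).
have hT := Lfun2_integrableM hL2 (P0_Lfun2 PT vL).
have hv'w := Lfun2_integrableM hL2 (Lfun2B wL v'L).
have -> : \int[mu]_x (h x * (v - w) x) =
   \int[mu]_x (h x * (v' x - w x)) + \int[mu]_x (h x * soft_step 0 e (v x)).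
  rewrite -RintegralD//; apply: eq_Rintegral => x _.
  by rewrite /v' !fctE/=; ring.
have : \int[mu]_x (h x * soft_step 0 e (v x)) <= e / 2 * H.
  rewrite /H -RintegralZl//; last exact: integrable_norm.
  apply: le_Rintegral => //.
    by exact: (integrableZl measurableT (e / 2) (integrable_norm h1)).
  move=> x _; rewrite mulrC (le_trans (ler_norm _))// normrM ler_wpM2r//.
  exact: soft_step_bound.
have : e / 2 * H <= eta.
  rewrite /e (_ : 2 * eta / (H + 1) / 2 = eta / (H + 1)); last first.
    by field; rewrite gt_eqF// ltr_wpDl.
  rewrite mulrAC ler_pdivrMr ?ltr_wpDl// ler_pM2l//.
  by rewrite lerDl.
by move: fv; lra.
Qed.

End resolvent.

Lemma resolvent_exists d (X : measurableType d) (R : realType)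
    (mu : {measure set X -> \bar R}) (E : (X -> R) -> \bar R)
    (b : R -> R) (K M delta : R) (f : X -> R) :
  proper_functional mu E -> lsc_functional mu E -> convex_functional mu E ->
  subgradient_part mu E (0, 0) ->
  (forall (u v : X -> R) (T : R -> R),
    u \in Lfun mu 2%:E -> v \in Lfun mu 2%:E -> P0 T ->
    (E (u + (T \o (v - u)))%R + E (v - (T \o (v - u)))%R <= E u + E v)%E) ->
  continuous b -> {homo b : x y / x <= y} -> (forall s, `|b s| <= K) -> b 0 = 0 ->
  0 < delta -> 0 < M -> L1capLoo mu f ->
  {ae mu, forall x, b (- M) <= f x <= b M} ->
  exists w : X -> R, [/\ w \in Lfun mu 2%:E, {ae mu, forall x, `|w x| <= M},
    b \o w \in Lfun mu 1%E,
    (\int[mu]_x `|((b \o w) x)%:E| <= \int[mu]_x `|(f x)%:E|)%E &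
    subgradient_part mu E (w, fun x => delta^-1 * (f x - delta * w x - b (w x)))].
Proof.
move=> Ep El Ec A0 Ecn bc bnd bK b0 d0 M0 f1 fM.
have [j j0 jb] := nondecreasing_primitive bc bnd.
have fL := L1capLoo_Lfun2 f1.
have [w wL [Ew Nw wmin]] := resolvent_minimizer Ep El Ec A0 bK b0 j0 jb d0 fL.
exists w; split => //.
- exact (resolvent_bounded Ep A0 Ecn bc bnd bK b0 j0 jb d0 M0 f1 fM wL Ew Nw wmin).
- exact: (resolvent_L1capLoo_comp Ep A0 Ecn bc bnd bK b0 j0 jb d0 f1 wL Ew Nw wmin).1.
- exact (resolvent_L1_contraction Ep A0 Ecn bc bnd bK b0 j0 jb d0 f1 wL Ew Nw wmin).
- exact (resolvent_subgradient Ep Ec A0 Ecn bc bnd bK b0 j0 jb d0 M0 f1 fM wL Ew Nw wmin).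
Qed.

(** * Density *)

(** If b(s_n) stays at distance e from b(r), continuity keeps s_n at some distance eta from r, and
    by monotonicity the product is at least e eta. The points s_n themselves need not converge, as
    [b] may be flat. *)
Lemma cvg_monotone_product (R : realType) (b : R -> R) (s_ : nat -> R) (r : R) :
  continuous b -> {homo b : x y / x <= y} ->
  (b r - b (s_ n)) * (r - s_ n) @[n --> \oo] --> 0 ->
  b (s_ n) @[n --> \oo] --> b r.
Proof.
move=> bc bnd c0; apply/cvgrPdist_lt => /= e e0.
have [eta /= eta0 beta] : exists2 eta : R, 0 < eta & forall s, `|r - s| < eta -> `|b r - b s| < e.
  have /cvgrPdist_lt/(_ _ e0)/nbhs_ballP[eta /= eta0 h] := bc r.
  by exists eta.
near=> n; rewrite ltNge; apply/negP => eb.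
have rs : eta <= `|r - s_ n|.
  by rewrite leNgt; apply/negP => /beta; rewrite ltNge eb.
have : (b r - b (s_ n)) * (r - s_ n) < e * eta.
  by near: n; apply: (cvgr_lt 0 c0); rewrite mulr_gt0.
apply/negP; rewrite -leNgt.
have -> : (b r - b (s_ n)) * (r - s_ n) = `|b r - b (s_ n)| * `|r - s_ n|.
  have [sr|/ltW sr] := leP (s_ n) r.
    by rewrite !ger0_norm ?subr_ge0 ?bnd.
  by rewrite !ler0_norm ?subr_le0 ?bnd// mulrNN.
by apply: ler_pM => //; exact: ltW.
Unshelve. all: by end_near. Qed.

Lemma increasing_surjective_inverse (R : realType) (phi : R -> R) :
  (forall s t, s < t -> phi s < phi t) -> (forall t, exists s, phi s = t) ->
  exists psi : R -> R, [/\ cancel psi phi, cancel phi psi,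
    {homo psi : x y / x <= y} & continuous psi].
Proof.
move=> inc /choice[psi psiK].
have mono s t : psi s < psi t -> s < t by move=> /inc; rewrite !psiK.
have phiK s : psi (phi s) = s.
  by have [/inc|/inc|//] := ltgtP (psi (phi s)) s; rewrite psiK ltxx.
have nd : {homo psi : x y / x <= y}.
  by move=> x y xy; rewrite leNgt; apply/negP => /mono; rewrite ltNge xy.
exists psi; split => // r; apply/cvgrPdist_lt => /= e e0.
have lr : phi (psi r - e) < r by rewrite -[ltRHS]psiK inc// ltrBlDr ltrDl.
have rr : r < phi (psi r + e) by rewrite -[ltLHS]psiK inc// ltrDl.
near=> s; rewrite distrC ltr_distl; apply/andP; split.
  have : phi (psi r - e) < s by near: s; exact: lt_nbhsr.
  move=> h; rewrite ltNge; apply/negP; rewrite le_eqVlt => /predU1P[sE|/inc].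
    by move: h; rewrite -sE psiK ltxx.
  by rewrite psiK ltNge (ltW h).
have : s < phi (psi r + e) by near: s; exact: lt_nbhsl.
move=> h; rewrite ltNge; apply/negP; rewrite le_eqVlt => /predU1P[sE|/inc].
  by move: h; rewrite sE psiK ltxx.
by rewrite psiK ltNge (ltW h).
Unshelve. all: by end_near. Qed.

Theorem corollary1p3 (d : measure_display) (X : measurableType d) (R : realType)
  (mu : {sigma_finite_measure set X -> \bar R})
  (E : (X -> R) -> \bar R) (phi : R -> R)
  (E_ae : ae_invariant mu E)
  (E_proper : proper_functional mu E)
  (E_lsc : lsc_functional mu E)
  (E_convex : convex_functional mu E)
  (phi_cont : continuous phi)
  (phi_incr : forall s t : R, s < t -> phi s < phi t)
  (phi_surj : forall t : R, exists s : R, phi s = t)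
  (phi0 : phi 0 = 0)
  (A0 : subgradient_part mu E (0, 0))
  (E_contr : forall (u v : X -> R) (T : R -> R),
     u \in Lfun mu 2%:E -> v \in Lfun mu 2%:E -> P0 T ->
     (E (u + (T \o (v - u)))%R + E (v - (T \o (v - u)))%R <= E u + E v)%E)
  (A_yosida : forall (lambda : R) (u v : X -> R),
     0 < lambda -> subgradient_part mu E (u, v) ->
     (0 <= \int[mu]_x (v x * yosida (inverse_fun phi) lambda (u x))%:E)%E /\
     (0 <= \int[mu]_x (v x * Num.sg (yosida (inverse_fun phi) lambda (u x)))%:E)%E)
  (E_pos_neg : forall u : X -> R, composed_domain mu E phi u ->
     composed_domain mu E phi (fun x => Num.max (u x) 0) /\
     composed_domain mu E phi (fun x => Num.min (u x) 0)) :
  L1_dense_in mu (composed_operator mu (subgradient_part mu E) phi).`1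
                 (composed_domain mu E phi).
Proof.
have [psi [psiK phiK psi_nd psi_cont]] := increasing_surjective_inverse phi_incr phi_surj.
have psi0 : psi 0 = 0 by rewrite -phi0 phiK.
split.
  (* Membership of phi(u) in the domain of A bounds phi(u), and the monotone inverse carries the
     bound over to u. *)
  move=> u [v [/= u1 _ _ [[Du _ _] [[_ /LfunooP[_ [M uM]]] _]]]].
  split => //; split => //; apply/LfunooP; split; first exact: Lfun_measurable u1.
  exists (Num.max (psi M) (- psi (- M))); apply: filterS uM => x /=.
  rewrite ler_norml => /andP[h1 h2]; rewrite ler_norml -(phiK (u x)) lerNl.
  by rewrite !le_max lerN2 (psi_nd _ _ h1) (psi_nd _ _ h2) orbT.
move=> f [f1 [/= w0L Ew0]].
have [fL1 /LfunooP[mf [K0 fK0]]] := f1.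
pose w0 := phi \o f.
pose K := `|K0|.
have fK : {ae mu, forall x, `|f x| <= K}.
  by apply: filterS fK0 => x /le_trans; apply; exact: ler_norm.
(* Large enough for phi to map [-K, K] into [-M, M]: then b = psi on the values of phi(f), and f
   lies between b(-M) and b(M). The [+ 1] makes [M] positive even if K = 0. *)
pose M := Num.max (phi K) (- phi (- K)) + 1.
have phi_nd : {homo phi : x y / x <= y}.
  by move=> x y; rewrite le_eqVlt => /predU1P[->//|/phi_incr/ltW].
have M1 : phi K <= M by rewrite ler_wpDr// le_max lexx.
have M2 : - M <= phi (- K) by rewrite lerNl ler_wpDr// le_max lexx orbT.
have phiK_ge0 : 0 <= phi K by rewrite -phi0; apply: phi_nd; exact: normr_ge0.
have M0 : 0 < M by rewrite ltr_wpDl// le_max phiK_ge0.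
pose clip s := Num.max (- M) (Num.min s M).
have clip_id s : `|s| <= M -> clip s = s.
  by rewrite ler_norml => /andP[? ?]; rewrite /clip (min_idPl _)// (max_idPr _).
have clip_nd : {homo clip : x y / x <= y}.
  move=> x y xy; rewrite /clip ge_max !le_max lexx/=.
  by apply/orP; right; rewrite le_min !ge_min xy lexx !orbT.
have clip_bnd s : - M <= clip s <= M.
  rewrite /clip le_max lexx/= ge_max ge_min lexx orbT andbT.
  by have := M0; lra.
have clip_cont : continuous clip.
  move=> s; apply: (@continuous_max R _ (fun=> - M) (fun s => Num.min s M)).
    exact: cvg_cst.
  by apply: (@continuous_min R _ id (fun=> M)); [exact: cvg_id|exact: cvg_cst].
pose b s := psi (clip s).
have b_nd : {homo b : x y / x <= y} by move=> x y xy; exact/psi_nd/clip_nd.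
have b_cont : continuous b.
  by move=> s; apply: continuous_comp; [exact: clip_cont|exact: psi_cont].
have bM s : `|s| <= M -> b s = psi s by move=> sM; rewrite /b clip_id.
have b0 : b 0 = 0 by rewrite bM ?normr0 ?(ltW M0).
pose Kb := Num.max (psi M) (- psi (- M)).
have bK s : `|b s| <= Kb.
  have /andP[h1 h2] := clip_bnd s; rewrite ler_norml lerNl /b /Kb !le_max lerN2.
  by rewrite (psi_nd _ _ h1) (psi_nd _ _ h2) orbT.
have fM : {ae mu, forall x, b (- M) <= f x <= b M}.
  apply: filterS fK => x; rewrite ler_norml => /andP[h1 h2].
  rewrite !bM ?normrN ?(gtr0_norm M0)//.
  rewrite (le_trans _ h1) ?(le_trans h2)//.
    by rewrite -(phiK K) psi_nd.
  by rewrite -(phiK (- K)) psi_nd.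
have w0M : {ae mu, forall x, b (w0 x) = f x}.
  apply: filterS fK => x fK; rewrite bM /w0/= ?phiK//.
  move: fK; rewrite !ler_norml => /andP[h1 h2].
  by rewrite (le_trans M2) ?phi_nd// (le_trans _ M1)// phi_nd.
pose delta n : R := 2^-1 ^+ n.
have delta0 n : 0 < delta n by rewrite exprn_gt0.
have /choice[w_ w_P] n := resolvent_exists E_proper E_lsc E_convex A0 E_contr
  b_cont b_nd bK b0 (delta0 n) M0 f1 fM.
(* With [psi] in place of [b], phi(g_n) = w_n holds at every point, as fits an operator on
   representatives; the bounds on b(w_n) carry over almost everywhere. *)
pose g n := psi \o w_ n.
have mw n : measurable_fun setT (w_ n) by have [/Lfun_measurable] := w_P n.
have mpsi : measurable_fun setT psi by exact: continuous_measurable_fun.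
have mbR : measurable_fun setT b by exact: continuous_measurable_fun.
have mg n : measurable_fun setT (g n) by exact: measurableT_comp.
have gb n : {ae mu, forall x, b (w_ n x) = g n x}.
  by have [_ wM _ _ _] := w_P n; apply: filterS wM => x; exact: bM.
have mabs (u : X -> R) : measurable_fun setT u ->
    measurable_fun setT (fun x => `|(u x)%:E|%E).
  by move=> ?; apply: measurableT_comp => //; exact/measurable_EFinP.
have Ig n : (\int[mu]_x `|(g n x)%:E| = \int[mu]_x `|((b \o w_ n) x)%:E|)%E.
  apply: ae_eq_integral => //; [exact: mabs|by apply: mabs; exact: measurableT_comp|].
  by apply: filterS (gb n) => x /= -> _.
have g1 n : g n \in Lfun mu 1%E.
  have [_ _ /Lfun1_integrable/integrableP[_ bi] _ _] := w_P n.
  apply/Lfun1_integrable/integrableP; split; first exact/measurable_EFinP.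
  by rewrite /= Ig.
exists g.
  move=> n; have [_ _ _ _ wA] := w_P n.
  have phig : phi \o g n = w_ n by apply/funext => x; rewrite /= psiK.
  eexists; split; [exact: g1| |rewrite phig; eexists; exact: wA|rewrite phig; exact: wA].
  by have [_ [_ []]] := wA.
have g_f : {ae mu, forall x, g n x @[n --> \oo] --> f x}.
  pose D n x := (b (w0 x) - b (w_ n x)) * (w0 x - w_ n x).
  have mw0 : measurable_fun setT w0 := Lfun_measurable w0L.
  have mD n : measurable_fun setT (D n).
    by apply: measurable_funM; apply: measurable_funB => //; exact: measurableT_comp.
  have D0 n x : 0 <= D n x.
    have [sr|/ltW sr] := leP (w_ n x) (w0 x).
      by rewrite mulr_ge0// subr_ge0// b_nd.
    by rewrite mulr_le0// subr_le0// b_nd.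
  have w02 := Lfun2_integrable_sqr w0L.
  (* The constant collects two bounds free of [n]: the subgradient inequality tested at w0 together
     with E(w_n) >= E(0), and w_n (w0 - w_n) <= w0^2. *)
  have DC n : (\int[mu]_x (D n x)%:E <= ((fine (E w0) - fine (E 0) +
      \int[mu]_x (w0 x ^+ 2)) * 2^-1 ^+ n)%R%:E)%E.
    have [wL _ b1 _ wA] := w_P n; set h := (X in (_, X)) in wA.
    have [[_ hL2 hsub] _] := wA.
    have w0w := Lfun2B wL w0L.
    have hi := Lfun2_integrableM hL2 w0w.
    have wi := Lfun2_integrableM wL w0w.
    (* Since b(w0) = f almost everywhere, the resolvent equation turns b(w0) - b(w_n) into delta_n
       (h + w_n). *)
    have ED : (\int[mu]_x (D n x)%:E =
        \int[mu]_x (delta n * (h x * (w0 - w_ n) x) + delta n * (w_ n x * (w0 - w_ n) x))%R%:E)%E.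
      have mh := Lfun_measurable hL2; have mww := Lfun_measurable w0w.
      apply: ae_eq_integral => //.
      - exact/measurable_EFinP.
      - apply/measurable_EFinP; apply: measurable_funD; apply: measurable_funM => //;
          exact: measurable_funM.
      apply: filterS w0M => x fx _; rewrite /D fx /h !fctE; congr EFin.
      by field; rewrite gt_eqF.
    have i1 := integrableZl measurableT (delta n) hi.
    have i2 := integrableZl measurableT (delta n) wi.
    rewrite ED -(fineK (integrable_fin_num measurableT (integrableD measurableT i1 i2))) lee_fin.
    rewrite -/(Rintegral mu setT _) RintegralD// !RintegralZl//.
    have w0fin := E_fin_num E_proper w0L Ew0.
    have hC : \int[mu]_x (h x * (w0 - w_ n) x) <= fine (E w0) - fine (E 0).
      have Ewn : (E (w_ n) < +oo)%E by have [[[]]] := wA.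
      have wnfin := E_fin_num E_proper wL Ewn.
      have := hsub _ w0L; rewrite /L2inner/=.
      rewrite -(fineK (integrable_fin_num measurableT hi)) -(fineK w0fin) -(fineK wnfin).
      rewrite -EFinB lee_fin -/(Rintegral mu setT _) => /le_trans; apply.
      have E0w := E_min E_proper A0 wL; have E0fin := E0_fin_num E_proper A0.
      by rewrite lerB// fine_le.
    have wS : \int[mu]_x (w_ n x * (w0 - w_ n) x) <= \int[mu]_x (w0 x ^+ 2).
      apply: le_Rintegral => // x _; rewrite !fctE.
      by have := sqr_ge0 (w_ n x - w0 x); have := sqr_ge0 (w_ n x);
        have := sqr_ge0 (w0 x); nra.
    rewrite -mulrDr mulrC; apply: ler_wpM2r; first exact: ltW.
    exact: lerD.
  have := ae_cvg0 mD D0 DC.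
  have gball := ae_foralln gb.
  move=> D_0; apply: filterS3 D_0 gball w0M => x Dx gx fx.
  rewrite -fx; under eq_fun do rewrite -gx.
  exact: cvg_monotone_product.
have := scheffe g1 fL1 g_f.
rewrite (_ : (fun n => 'N[mu]_1[EFin \o (g n - f)%R]%E) =
  (fun n => (\int[mu]_x `|(g n x - f x)%:E|)%E)); last first.
  by apply/funext => n; rewrite Lnorm1.
by apply => n; rewrite Ig; have [] := w_P n.
Qed.
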